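(* Let $N$ and $M$ be II$_1$-factors. The operation $+$ on $\mathrm{Hom}(N,M^\infty)$ given by $[\phi]+[\psi]:=[\tilde\phi+\psi]$, where $\tilde\phi$ is a representative of $[\phi]$ with $\tilde\phi(1)\perp\psi(1)$, is well-defined and makes $\mathrm{Hom}(N,M^\infty)$ an abelian semigroup.
   Context: $H$ is a separable infinite-dimensional Hilbert space. $M^\infty\subset B(H)\bar\otimes M$ is the algebraic ideal generated by the projections of finite trace. $\mathrm{Hom}(N,M^\infty)$ is the set of $*$-homomorphisms $\pi\colon N\to M^\infty$ (not necessarily unital, possibly zero) modulo conjugation by unitaries of $B(H)\bar\otimes M$: $[\pi_1]=[\pi_2]$ iff there is a unitary $u\in B(H)\bar\otimes M$ with $\pi_1=\mathrm{Ad}\,u\circ\pi_2$. A representative $\tilde\phi$ as required always exists because $\phi(1)$ and $\psi(1)$ have finite trace. *)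

(* Defs.v *)
From HB Require Import structures.
From mathcomp Require Import all_boot all_order all_algebra generic_quotient.
From mathcomp Require Import complex.
From mathcomp Require Import all_classical all_reals.
From mathcomp Require Import ereal topology normedtype sequences.

Set Implicit Arguments.
Unset Strict Implicit.
Unset Printing Implicit Defensive.

Import Order.TTheory GRing.Theory Num.Theory.
Import numFieldNormedType.Exports.

Local Open Scope classical_set_scope.
Local Open Scope ring_scope.
Local Open Scope complex_scope.
Local Open Scope quotient_scope.

(* [hinner] is linear in its first and conjugate-linear in its second variable. *)
HB.mixin Record NormedModule_isHilbert (R : realType) (K : Type)
    of CompleteNormedModule R[i] K := {
  hinner : {dot K for (@Num.conj R[i])};
  sqr_normE : forall x : K, `|x| ^+ 2 = hinner x x
}.

#[short(type="hilbertType")]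
HB.structure Definition Hilbert (R : realType) :=
  {K of NormedModule_isHilbert R K & CompleteNormedModule R[i] K}.

Notation "⟪ x , y ⟫" := (hinner x y)
  (at level 0, x, y at level 200, format "⟪ x ,  y ⟫") : ring_scope.

Definition infinite_dimensional (C : nzRingType) (V : lmodType C) (S : set V) :=
  forall (n : nat) (b : 'I_n -> V),
    ~ (S `<=` [set x | exists c : 'I_n -> C, x = \sum_(i < n) c i *: b i]).

Definition separable (T : topologicalType) :=
  exists2 D : set T, countable D & dense D.

Section Operators.
Variables (R : realType) (K : hilbertType R).
Implicit Types (S T : K -> K) (M I : set (K -> K)).

(* [bounded_ops] is B(K); it is cut out of the lmodType of all functions
   [K -> K], in which the product of operators is composition. *)
Definition bounded_ops : set (K -> K) := [set T | linear T /\ continuous T].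

(* [is_adjoint S T] means T = S^*. *)
Definition is_adjoint S T := forall x y, ⟪S x, y⟫ = ⟪x, T y⟫.

Definition positive_op T := forall x, 0 <= ⟪T x, x⟫.

Definition projection T := T \o T = T /\ is_adjoint T T.

Definition commutant M : set (K -> K) :=
  [set T | bounded_ops T /\ forall S, M S -> T \o S = S \o T].

Definition von_neumann_algebra M :=
  [/\ M `<=` bounded_ops,
      forall S T, M S -> bounded_ops T -> is_adjoint S T -> M T
    & commutant (commutant M) = M].

Definition factor M :=
  von_neumann_algebra M /\
  M `&` commutant M = [set T | exists c : R[i], T = c *: idfun].

Definition op_lub M (D : set (K -> K)) T :=
  [/\ M T, forall S, D S -> positive_op (T - S)
    & forall T', M T' -> (forall S, D S -> positive_op (T' - S)) ->
        positive_op (T' - T)].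

Definition op_directed (D : set (K -> K)) :=
  D !=set0 /\
  forall S T, D S -> D T ->
    exists U, [/\ D U, positive_op (U - S) & positive_op (U - T)].

(* Only the values of [tau] on [M] matter.  In the order of R[i], [0 <= z]
   means that z is real and nonnegative; the last clause is normality. *)
Definition faithful_normal_tracial_state M (tau : (K -> K) -> R[i]) :=
  [/\ forall (a : R[i]) S T, M S -> M T ->
        tau (a *: S + T) = a * tau S + tau T,
      tau idfun = 1,
      forall S T, M S -> M T -> tau (S \o T) = tau (T \o S),
      forall T, M T -> positive_op T ->
        0 <= tau T /\ (tau T = 0 -> T = 0)
    & forall (D : set (K -> K)) T, D `<=` M -> D `<=` positive_op ->
        op_directed D -> op_lub M D T ->
        (forall S, D S -> tau S <= tau T) /\
        forall c, (forall S, D S -> tau S <= c) -> tau T <= c].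

Definition two_sided_ideal M I :=
  [/\ I `<=` M, I 0, forall S T, I S -> I T -> I (S + T)
    & forall S T, M S -> I T -> I (S \o T) /\ I (T \o S)].

End Operators.

Lemma comp_idP (T1 T2 : Type) (f : T2 -> T1) (g : T1 -> T2) :
  f \o g = idfun -> cancel g f.
Proof. by move=> fg x; have := congr1 (@^~ x) fg. Qed.

Section OperatorLemmas.
Variables (R : realType) (K : hilbertType R).
Implicit Types (S T U : K -> K) (M : set (K -> K)).

Lemma hinnerC (x y : K) : ⟪x, y⟫ = (⟪y, x⟫^*)%R.
Proof. by have := hermC hinner x y; rewrite expr0 mul1r. Qed.

Lemma hinnerDl (x y z : K) : ⟪x + y, z⟫ = ⟪x, z⟫ + ⟪y, z⟫.
Proof. exact: (linearDl hinner). Qed.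

Lemma hinnerDr (x y z : K) : ⟪x, y + z⟫ = ⟪x, y⟫ + ⟪x, z⟫.
Proof. exact: (linearDr hinner). Qed.

Lemma is_adjointC S T : is_adjoint S T -> is_adjoint T S.
Proof. by move=> ST x y; rewrite hinnerC -ST -hinnerC. Qed.

Lemma is_adjointD S T S' T' : is_adjoint S S' -> is_adjoint T T' ->
  is_adjoint (S + T) (S' + T').
Proof.
move=> SS' TT' x y; rewrite [(S + T) x]/(S x + T x) [(S' + T') y]/(S' y + T' y).
by rewrite hinnerDl hinnerDr SS' TT'.
Qed.

Lemma is_adjoint_comp S T S' T' : is_adjoint S S' -> is_adjoint T T' ->
  is_adjoint (S \o T) (T' \o S').
Proof. by move=> SS' TT' x y; rewrite /= SS' TT'. Qed.

Lemma is_adjoint_uniq S T T' : is_adjoint S T -> is_adjoint S T' -> T = T'.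
Proof.
move=> ST ST'; apply/funext => y; apply/eqP; rewrite -subr_eq0.
apply: contraT => /(neq0_dnorm_gt0 (s := hinner)).
suff -> : ⟪T y - T' y, T y - T' y⟫ = 0 by rewrite ltxx.
by rewrite [LHS](linearBr hinner) -[X in X - _]ST -[X in _ - X]ST' subrr.
Qed.

Lemma op_compDl S T U : (S + T) \o U = (S \o U) + (T \o U).
Proof. by []. Qed.

Lemma op_compDr S T U : linear S -> S \o (T + U) = (S \o T) + (S \o U).
Proof.
move=> lS; apply/funext => x.
by have := lS 1 (T x) (U x); rewrite !scale1r.
Qed.

Lemma op_comp0r S : linear S -> S \o 0 = 0 :> (K -> K).
Proof.
move=> lS; apply/funext => x.
by have := lS (-1) 0 0; rewrite !scaleN1r oppr0 addr0 addNr.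
Qed.

Lemma commutant_id M : M `<=` @bounded_ops R K -> commutant M idfun.
Proof. by move=> _; split=> //; split=> // x; exact: cvg_id. Qed.

Lemma commutant0 M : M `<=` @bounded_ops R K -> commutant M 0.
Proof.
move=> Mb; split=> [|U /Mb[lU _]]; last by rewrite op_comp0r.
by split=> [a x y|x]; rewrite ?scaler0 ?addr0 //; exact: cvg_cst.
Qed.

Lemma commutantD M S T : M `<=` @bounded_ops R K ->
  commutant M S -> commutant M T -> commutant M (S + T).
Proof.
move=> Mb [[lS cS] SM] [[lT cT] TM]; split=> [|U MU].
  split=> [a x y /=|x]; last by apply: cvgD; [exact: cS|exact: cT].
  by rewrite /GRing.add/= lS lT scalerDr addrACA.
by have [lU _] := Mb _ MU; rewrite op_compDl op_compDr// SM// TM.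
Qed.

Lemma commutant_comp M S T :
  commutant M S -> commutant M T -> commutant M (S \o T).
Proof.
move=> [[lS cS] SM] [[lT cT] TM]; split=> [|U MU].
  split=> [a x y /=|x]; first by rewrite lT lS.
  by apply: continuous_comp; [exact: cT|exact: cS].
by rewrite -compA TM // compA SM.
Qed.

End OperatorLemmas.

(* The trace of a II_1 factor is unique, so carrying it adds no structure. *)
Record II1_factor (R : realType) (K : hilbertType R) := II1Factor {
  II1_ops : set (K -> K);
  II1_tr : (K -> K) -> R[i];
  II1_factorP : factor II1_ops;
  II1_infinite : infinite_dimensional II1_ops;
  II1_trP : faithful_normal_tracial_state II1_ops II1_tr
}.

Definition orthonormal_basis (R : realType) (H : hilbertType R) (e : nat -> H) :=
  (forall i j, ⟪e i, e j⟫ = (i == j)%:R) /\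
  dense [set v | exists (n : nat) (c : nat -> R[i]), v = \sum_(i < n) c i *: e i].

(* A Hilbert space tensor product of H and K: these properties determine the
   space [ht_space] and the map [ht_tensor] up to a unique unitary. *)
Record hilbert_tensor (R : realType) (H K : hilbertType R) := HilbertTensor {
  ht_space :> hilbertType R;
  ht_tensor : {bilinear H -> K -> ht_space};
  ht_inner : forall h k h' k',
    ⟪ht_tensor h k, ht_tensor h' k'⟫ = ⟪h, h'⟫ * ⟪k, k'⟫;
  ht_dense : dense [set v | exists (n : nat) (h : nat -> H) (k : nat -> K),
    v = \sum_(i < n) ht_tensor (h i) (k i)]
}.

Section Amplification.
Variables (R : realType) (H K : hilbertType R) (L : hilbert_tensor H K).
Variable M : II1_factor K.
Local Notation "h ⊗ k" := (ht_tensor L h k) (at level 35).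

Definition elementary_tensor_op (T : L -> L) :=
  bounded_ops T /\
  exists a x, [/\ bounded_ops a, II1_ops M x & forall h k, T (h ⊗ k) = a h ⊗ x k].

(* B(H) \bar\otimes M, the von Neumann algebra generated by the a ⊗ x. *)
Definition amplification : set (L -> L) :=
  commutant (commutant elementary_tensor_op).

(* [d] is the i-th diagonal entry of T w.r.t. the decomposition of L along [e]. *)
Definition diagonal_entry (e : nat -> H) (T : L -> L) (i : nat) (d : K -> K) :=
  II1_ops M d /\ forall x y, ⟪d x, y⟫ = ⟪T (e i ⊗ x), e i ⊗ y⟫.

(* (Tr ⊗ tau)(T) = \sum_i tau(T_ii) < +oo, for positive T; the value does not
   depend on the orthonormal basis. *)
Definition finite_trace (T : L -> L) :=
  exists (e : nat -> H) (d : nat -> K -> K),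
    [/\ orthonormal_basis e, forall i, diagonal_entry e T i (d i)
      & (\sum_(0 <= i <oo) (complex.Re (II1_tr M (d i)))%:E < +oo)%E].

Definition finite_projections : set (L -> L) :=
  [set p | [/\ amplification p, projection p & finite_trace p]].

(* M^\infty.  Ideals of the unital algebra [amplification] are closed under
   scalars because they absorb the operators [c *: idfun]. *)
Definition finite_ideal : set (L -> L) :=
  smallest (two_sided_ideal amplification) finite_projections.

Lemma commutant_ops S : @commutant R L S `<=` @bounded_ops R L.
Proof. by move=> T []. Qed.

Lemma amplification_id : amplification idfun.
Proof. by apply: commutant_id; exact: commutant_ops. Qed.

Lemma amplification_comp S T :
  amplification S -> amplification T -> amplification (S \o T).
Proof. exact: commutant_comp. Qed.

Lemma amplification_ideal : two_sided_ideal amplification amplification.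
Proof.
split=> // [|S T|S T AS AT]; last by split; exact: amplification_comp.
- by apply: commutant0; exact: commutant_ops.
- by apply: commutantD; exact: commutant_ops.
Qed.

Lemma finite_ideal_ops : finite_ideal `<=` @bounded_ops R L.
Proof.
move=> T /(_ amplification) []//; split; first exact: amplification_ideal.
by move=> p [].
Qed.

Lemma finite_idealD S T :
  finite_ideal S -> finite_ideal T -> finite_ideal (S + T).
Proof.
move=> IS IT I II; have [[_ _ ID _] _] := II.
by apply: ID; [exact: IS|exact: IT].
Qed.

End Amplification.

Arguments amplification {R H K} L M.
Arguments finite_ideal {R H K} L M.

Section Factor.
Variables (R : realType) (K : hilbertType R) (N : II1_factor K).

Lemma II1_id : II1_ops N idfun.
Proof.
have [[_ _ <-] _] := II1_factorP N.
by apply: commutant_id => T [].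
Qed.

End Factor.

Section Hom.
Variables (R : realType) (H KN K : hilbertType R) (L : hilbert_tensor H K).
Variables (N : II1_factor KN) (M : II1_factor K).
Local Notation A := (amplification L M).
Local Notation Minf := (finite_ideal L M).

(* Only the values of [shom] on N matter: [HomInf] below identifies two records
   that agree on N. *)
Record star_hom := StarHom {
  shom :> (KN -> KN) -> (L -> L);
  shom_in : forall x, II1_ops N x -> Minf (shom x);
  shom_lin : forall (a : R[i]) x y, II1_ops N x -> II1_ops N y ->
    shom (a *: x + y) = a *: shom x + shom y;
  shom_mul : forall x y, II1_ops N x -> II1_ops N y ->
    shom (x \o y) = shom x \o shom y;
  shom_star : forall x y, II1_ops N x -> II1_ops N y -> is_adjoint x y ->
    is_adjoint (shom x) (shom y)
}.
HB.instance Definition _ := gen_eqMixin star_hom.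
HB.instance Definition _ := gen_choiceMixin star_hom.

(* p1 = Ad u \o p2 on N for a unitary u of B(H) \bar\otimes M; v is u^*. *)
Definition unitary_conj (p1 p2 : star_hom) := exists u v : L -> L,
  [/\ [/\ A u, A v & is_adjoint u v], u \o v = idfun, v \o u = idfun
    & forall x, II1_ops N x -> p1 x = u \o p2 x \o v].

Lemma unitary_conj_refl : reflexive (fun p q => `[< unitary_conj p q >]).
Proof.
move=> p; apply/asboolP; exists idfun, idfun; split=> //.
by split=> //; exact: amplification_id.
Qed.

Lemma unitary_conj_sym p q : unitary_conj p q -> unitary_conj q p.
Proof.
move=> [u [v [[Au Av uv] uvK vuK pq]]]; exists v, u.
split=> // [|x Nx]; first by split=> //; exact: is_adjointC.
apply/funext => z; rewrite pq //=.
by rewrite !(comp_idP vuK).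
Qed.

Lemma unitary_conj_trans p q r :
  unitary_conj p q -> unitary_conj q r -> unitary_conj p r.
Proof.
move=> [u [v [[Au Av uv] uvK vuK pq]]] [u' [v' [[Au' Av' uv'] uvK' vuK' qr]]].
exists (u \o u'), (v' \o v); split=> [|||x Nx].
- split; [exact: amplification_comp|exact: amplification_comp|].
  exact: is_adjoint_comp.
- by apply/funext => z /=; rewrite (comp_idP uvK') (comp_idP uvK).
- by apply/funext => z /=; rewrite (comp_idP vuK) (comp_idP vuK').
- by rewrite pq // qr.
Qed.

Lemma unitary_conj_symb : symmetric (fun p q => `[< unitary_conj p q >]).
Proof. by move=> p q; apply/asboolP/asboolP; exact: unitary_conj_sym. Qed.

Lemma unitary_conj_transb : transitive (fun p q => `[< unitary_conj p q >]).
Proof.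
move=> q p r /asboolP pq /asboolP qr; apply/asboolP.
exact: unitary_conj_trans pq qr.
Qed.

Definition unitary_conj_equiv : equiv_rel star_hom :=
  EquivRel _ unitary_conj_refl unitary_conj_symb unitary_conj_transb.

(* Hom(N, M^\infty) *)
Definition HomInf := {eq_quot unitary_conj_equiv}.

Definition hom_class (p : star_hom) : HomInf := \pi p.

(* p(1) and q(1) are projections, so this is p(1) \perp q(1). *)
Definition orthogonal_homs (p q : star_hom) := p idfun \o q idfun = 0.

Section Sum.
Variables (p q : star_hom) (pq : orthogonal_homs p q).

Lemma orthogonal_homsC : q idfun \o p idfun = 0.
Proof.
have Nid := II1_id N; have id_id : is_adjoint (@idfun KN) idfun by [].
have /is_adjoint_comp := shom_star p Nid Nid id_id.
move=> /(_ _ _ (shom_star q Nid Nid id_id)); rewrite pq => /is_adjoint_uniq.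
apply => x y; rewrite [RHS](linear0r hinner); exact: (linear0l hinner).
Qed.

Lemma shom_linear (r : star_hom) x : II1_ops N x -> linear (r x).
Proof. by move=> Nx; have [] := finite_ideal_ops (shom_in r Nx). Qed.

Lemma orthogonal_homs_cross (r s : star_hom) x y : s idfun \o r idfun = 0 ->
  II1_ops N x -> II1_ops N y -> s x \o r y = 0.
Proof.
move=> sr Nx Ny; have Nid := II1_id N.
rewrite -[s x]/(s (x \o idfun)) -[r y]/(r (idfun \o y)).
rewrite (shom_mul s)// (shom_mul r)//.
apply/funext => z.
have /= -> := congr1 (@^~ (r y z)) sr.
exact: (congr1 (@^~ z) (op_comp0r (shom_linear s Nx))).
Qed.

Definition sum_hom_fun x := p x + q x.

Lemma sum_hom_in x : II1_ops N x -> Minf (sum_hom_fun x).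
Proof. by move=> Nx; apply: finite_idealD; exact: shom_in. Qed.

Lemma sum_hom_lin (a : R[i]) x y : II1_ops N x -> II1_ops N y ->
  sum_hom_fun (a *: x + y) = a *: sum_hom_fun x + sum_hom_fun y.
Proof.
by move=> Nx Ny; rewrite /sum_hom_fun !shom_lin// scalerDr addrACA.
Qed.

Lemma sum_hom_mul x y : II1_ops N x -> II1_ops N y ->
  sum_hom_fun (x \o y) = sum_hom_fun x \o sum_hom_fun y.
Proof.
move=> Nx Ny; rewrite /sum_hom_fun (shom_mul p Nx Ny) (shom_mul q Nx Ny).
rewrite op_compDl (op_compDr _ _ (shom_linear p Nx)).
rewrite (op_compDr _ _ (shom_linear q Nx)).
rewrite (orthogonal_homs_cross pq Nx Ny).
rewrite (orthogonal_homs_cross orthogonal_homsC Nx Ny).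
by rewrite addr0 add0r.
Qed.

Lemma sum_hom_star x y : II1_ops N x -> II1_ops N y -> is_adjoint x y ->
  is_adjoint (sum_hom_fun x) (sum_hom_fun y).
Proof. by move=> Nx Ny xy; apply: is_adjointD; exact: shom_star. Qed.

Definition sum_hom : star_hom :=
  StarHom sum_hom_in sum_hom_lin sum_hom_mul sum_hom_star.

End Sum.

End Hom.

Arguments HomInf {R H KN K} L N M.

(* Main.v *)
Require Import Defs.
From HB Require Import structures.
From mathcomp Require Import all_boot all_order all_algebra generic_quotient.
From mathcomp Require Import complex.
From mathcomp Require Import all_classical all_reals.
From mathcomp Require Import ereal topology normedtype sequences.
From mathcomp Require Import ring lra zify.

(* Every projection p of M^oo has an isometry s in B(H) (x) M with s s^* = 1 - p.
   Granting this, a partial isometry w with w^* w = p and w w^* = q in M^oo extends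
   to the unitary w + s_q s_p^*; hence representatives can be moved to be
   orthogonal, and sums of equivalent orthogonal homomorphisms are equivalent.

   No comparison theory is used to find s.  The Hilbert-Schmidt operators for
   Tr (x) tau form an ideal containing M^oo.  Starting from q_0 = p, choose indices
   n_j for which the n_j-th diagonal entry of q_j has small trace, put
   x_j = (1 - q_j) E_(n_j, i_j), where every i occurs infinitely often as an i_j,
   and let q_(j+1) be q_j plus the range projection of x_j.  Then
   y = sum_j 2^-(j+1) x_j satisfies p y = 0, and it is injective because the trace
   tau is faithful.  Its polar part t is an isometry with p t = 0, and a Hilbert
   hotel along the projections t^n p t^*n yields s.  Polar parts are obtained as
   strong limits of the Newton-Schulz iteration, so no square roots are needed. *)

Set Implicit Arguments.
Unset Strict Implicit.
Unset Printing Implicit Defensive.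

Import Order.TTheory GRing.Theory Num.Theory.
Import numFieldNormedType.Exports.

Local Open Scope classical_set_scope.
Local Open Scope ring_scope.
Local Open Scope complex_scope.
Local Open Scope quotient_scope.

(** * The real inner product and sequential convergence *)

(** The obstacle is that conjugacy asks for unitaries of the whole algebra: a partial isometry
    between finite projections settles nothing until their complements, which are infinite, are
    matched too. Comparing each complement with 1, not with the other one, separates the two
    problems.

    [finite_ideal] is a smallest ideal, so its elements are accessible only through ideals that
    contain the finite projections; moreover [finite_trace] lets every projection bring its own
    basis. The Hilbert-Schmidt condition copes with both, because one exchange of sums ([hs_swap])
    makes it invariant under adjoints and under change of basis. The construction of t uses
    finiteness only through diagonal entries of small trace.

    Injectivity of y rests on orthogonality: x_j is killed by q_j and lands in q_(j+1), so y u = 0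
    forces x_j u = 0 for all j. Then q_j contains the image of ker y under E_(n_j, i_j). For a fixed
    i = i_j this keeps the n_j-th diagonal trace of q_j above a positive constant, against the
    choice of n_j. *)

Section RealInner.
Variables (R : realType) (K : hilbertType R).
Implicit Types (x y z : K) (u : nat -> K).

(** Real parts keep all estimates in the ordered field [R]. Nothing is lost: replacing [x] by
    ['i *: x] recovers the imaginary part ([hinner_rdot]). *)
Definition rdot x y : R := complex.Re ⟪x, y⟫.
Definition nsq x : R := rdot x x.

Lemma hinnerZl (a : R[i]) x y : ⟪a *: x, y⟫ = a * ⟪x, y⟫.
Proof. exact: (linearZl_LR hinner). Qed.

Lemma hinnerZr (a : R[i]) x y : ⟪x, a *: y⟫ = (a^*)%C * ⟪x, y⟫.
Proof. exact: (linearZr_LR hinner). Qed.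

Lemma rdotC x y : rdot x y = rdot y x.
Proof. by rewrite /rdot hinnerC; case: (⟪y, x⟫). Qed.

Lemma rdotDl x y z : rdot (x + y) z = rdot x z + rdot y z.
Proof. by rewrite /rdot hinnerDl raddfD. Qed.

Lemma rdotNl x z : rdot (- x) z = - rdot x z.
Proof. by rewrite /rdot [X in complex.Re X](linearNl hinner) raddfN. Qed.

Lemma rdotBl x y z : rdot (x - y) z = rdot x z - rdot y z.
Proof. by rewrite rdotDl rdotNl. Qed.

Lemma rdotDr x y z : rdot x (y + z) = rdot x y + rdot x z.
Proof. by rewrite !(rdotC x) rdotDl. Qed.

Lemma rdotNr x y : rdot x (- y) = - rdot x y.
Proof. by rewrite !(rdotC x) rdotNl. Qed.

Lemma rdotZl (r : R) x y : rdot (r%:C *: x) y = r * rdot x y.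
Proof. by rewrite /rdot hinnerZl; case: (⟪x, y⟫) => a b /=; rewrite mul0r subr0. Qed.

Lemma rdotZr (r : R) x y : rdot x (r%:C *: y) = r * rdot x y.
Proof. by rewrite rdotC rdotZl rdotC. Qed.

Lemma rdot0l x : rdot 0 x = 0.
Proof. by rewrite -(subrr 0) rdotBl subrr. Qed.

Lemma rdot0r x : rdot x 0 = 0. Proof. by rewrite rdotC rdot0l. Qed.

Lemma rdot_suml I (r : seq I) (P : pred I) (F : I -> K) x :
  rdot (\sum_(i <- r | P i) F i) x = \sum_(i <- r | P i) rdot (F i) x.
Proof. exact: (big_morph (rdot^~ x) (fun y z => rdotDl y z x) (rdot0l x)). Qed.

Lemma rdot_i x y : rdot ('i *: x) y = - complex.Im ⟪x, y⟫.
Proof.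
by rewrite /rdot hinnerZl; case: (⟪x, y⟫) => a b /=; rewrite mul0r mul1r sub0r.
Qed.

Lemma hinner_rdot x y : ⟪x, y⟫ = rdot x y +i* - rdot ('i *: x) y.
Proof. by rewrite rdot_i opprK /rdot; case: (⟪x, y⟫). Qed.

Lemma hinner_nsq x : ⟪x, x⟫ = (nsq x)%:C.
Proof.
rewrite hinner_rdot /nsq rdot_i; have := hinnerC x x.
by case: (⟪x, x⟫) => a b /= -[e]; rewrite [X in _ +i* X](_ : _ = 0)//; lra.
Qed.

Lemma normsqE x : `|x| ^+ 2 = (nsq x)%:C.
Proof. by rewrite sqr_normE hinner_nsq. Qed.

Lemma nsq_ge0 x : 0 <= nsq x.
Proof. by rewrite -lecR -normsqE exprn_ge0. Qed.

Lemma nsq_eq0 x : nsq x = 0 -> x = 0.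
Proof.
move=> x0; apply/eqP; rewrite -normr_eq0 -sqrf_eq0.
by rewrite normsqE x0.
Qed.

Lemma nsq0 : nsq 0 = 0. Proof. exact: rdot0l. Qed.

Lemma nsqN x : nsq (- x) = nsq x.
Proof. by rewrite /nsq rdotNl rdotNr opprK. Qed.

Lemma nsqD x y : nsq (x + y) = nsq x + nsq y + 2 * rdot x y.
Proof. rewrite /nsq !rdotDl !rdotDr (rdotC y x); lra. Qed.

Lemma nsqB x y : nsq (x - y) = nsq x + nsq y - 2 * rdot x y.
Proof. by rewrite nsqD nsqN rdotNr mulrN. Qed.

Lemma nsqBC x y : nsq (x - y) = nsq (y - x).
Proof. by rewrite -opprB nsqN. Qed.

Lemma nsqZ (r : R) x : nsq (r%:C *: x) = r ^+ 2 * nsq x.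
Proof. by rewrite /nsq rdotZl rdotZr mulrA. Qed.

Lemma nsq_i x : nsq ('i *: x) = nsq x.
Proof.
rewrite /nsq /rdot hinnerZl hinnerZr.
case: (⟪x, x⟫) => a b /=.
by rewrite !(mul0r, mul1r, sub0r, addr0, oppr0, mulN1r, opprK).
Qed.

Lemma nsqD_le x y : nsq (x + y) <= 2 * nsq x + 2 * nsq y.
Proof. by have := nsq_ge0 (x - y); rewrite nsqB nsqD; lra. Qed.

(** Expand [nsq (t%:C *: x - y) >= 0] and divide by [t]. This linear form of Cauchy-Schwarz needs no
    square root; the weight [t] is tuned at each use. *)
Lemma rdot_le_nsq (t : R) x y : 0 < t -> 2 * rdot x y <= t * nsq x + t^-1 * nsq y.
Proof.
move=> t0; have := nsq_ge0 (t%:C *: x - y).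
rewrite nsqB nsqZ rdotZl => h.
have : 0 <= t^-1 * (t ^+ 2 * nsq x + nsq y - 2 * (t * rdot x y)).
  by rewrite mulr_ge0// invr_ge0 ltW.
suff -> : t^-1 * (t ^+ 2 * nsq x + nsq y - 2 * (t * rdot x y)) =
  t * nsq x + t^-1 * nsq y - 2 * rdot x y by lra.
by field; rewrite gt_eqF.
Qed.

Lemma rdot_ext x y : (forall z, rdot x z = rdot y z) -> x = y.
Proof.
move=> xy; apply/eqP; rewrite -subr_eq0; apply/eqP/nsq_eq0.
by rewrite /nsq rdotBl xy subrr.
Qed.

Lemma rdot_eq0 x : (forall z, rdot x z = 0) -> x = 0.
Proof. by move=> x0; apply: rdot_ext => z; rewrite x0 rdot0l. Qed.

(* Squared distances live in [R], unlike the norm, which is [R[i]]-valued. *)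
Definition scvg u x := forall e : R, 0 < e ->
  exists n0, forall n, (n0 <= n)%N -> nsq (u n - x) < e.

Lemma norm_lt_nsq x (e : R) : 0 < e -> (`|x| < e%:C) = (nsq x < e ^+ 2).
Proof.
move=> e0; have eC : 0 <= e%:C by rewrite lecR ltW.
by rewrite -(ltr_pXn2r (n := 2)) ?nnegrE// normsqE -rmorphXn/= ltcR.
Qed.

Lemma complex_pos (e : R[i]) : 0 < e -> exists2 r : R, 0 < r & e = r%:C.
Proof.
case: e => a b; rewrite ltcE/= => /andP[/eqP-> a0].
by exists a.
Qed.

Lemma scvgP u x : u @ \oo --> x <-> scvg u x.
Proof.
split=> [/cvgrPdist_lt ux e e0|ux].
  have [n0 _ h] : \forall n \near \oo, `|x - u n| < (Num.sqrt e)%:C.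
    by apply: ux; rewrite ltcR sqrtr_gt0.
  exists n0 => n /h; rewrite norm_lt_nsq ?sqrtr_gt0// sqr_sqrtr ?ltW//.
  by rewrite nsqBC.
apply/cvgrPdist_lt => e /complex_pos[r r0 ->].
have [|n0 h] := ux (r ^+ 2); first by rewrite exprn_gt0.
exists n0 => // n /= /h.
by rewrite norm_lt_nsq// nsqBC.
Qed.

Lemma scvg_cauchy u :
  (forall e : R, 0 < e ->
     exists n0, forall m n, (n0 <= n <= m)%N -> nsq (u m - u n) < e) ->
  exists x, scvg u x.
Proof.
move=> cu; suff : cvgn u by move=> uc; exists (limn u); exact/scvgP.
apply/cauchy_cvgP/cauchyP => e /complex_pos[r r0 ->].
have [|n0 h] := cu (r ^+ 2); first by rewrite exprn_gt0.
exists (u n0); exists n0 => // m /= nm.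
rewrite -ball_normE/=.
by rewrite norm_lt_nsq// nsqBC h// leqnn.
Qed.

Lemma scvg_uniq u x y : scvg u x -> scvg u y -> x = y.
Proof.
move=> ux uy; apply/eqP; rewrite -subr_eq0; apply/eqP/nsq_eq0.
apply/eqP; rewrite eq_le nsq_ge0 andbT; apply/ler_addgt0Pl => e e0; rewrite addr0.
have e4 : 0 < e / 4 by rewrite divr_gt0.
have [n1 h1] := ux _ e4; have [n2 h2] := uy _ e4.
have {}h1 := h1 _ (leq_maxl n1 n2); have {}h2 := h2 _ (leq_maxr n1 n2).
set n := maxn n1 n2 in h1 h2.
rewrite (_ : x - y = (x - u n) + (u n - y)); last by rewrite addrA subrK.
by have := nsqD_le (x - u n) (u n - y); rewrite (nsqBC x); lra.
Qed.

Lemma scvg_cst x : scvg (fun=> x) x.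
Proof. by move=> e e0; exists 0 => n _; rewrite subrr nsq0. Qed.

Lemma scvg_ev u v x n0 : (forall n, (n0 <= n)%N -> u n = v n) -> scvg u x -> scvg v x.
Proof.
move=> uv ux e /ux[n1 h]; exists (maxn n0 n1) => n; rewrite geq_max => /andP[a b].
by rewrite -uv// h.
Qed.

Lemma eq_scvg u v x : u =1 v -> scvg u x -> scvg v x.
Proof. by move=> uv; apply: (@scvg_ev _ _ _ 0) => n _. Qed.

Lemma scvg_shift u x : scvg u x -> scvg (fun n => u n.+1) x.
Proof. by move=> ux e /ux[n1 h]; exists n1 => n nn; rewrite h// leqW. Qed.

Lemma scvgD u v x y : scvg u x -> scvg v y -> scvg (fun n => u n + v n) (x + y).
Proof.
move=> ux uy e e0; have e4 : 0 < e / 4 by rewrite divr_gt0.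
have [n1 h1] := ux _ e4; have [n2 h2] := uy _ e4.
exists (maxn n1 n2) => n; rewrite geq_max => /andP[/h1 {}h1 /h2 {}h2].
rewrite opprD addrACA.
by have := nsqD_le (u n - x) (v n - y); lra.
Qed.

Lemma scvg_rdot u x y : scvg u x -> (fun n => rdot (u n) y) @ \oo --> rdot x y.
Proof.
move=> ux; apply/cvgrPdist_lt => e e0.
(* The weight makes [t^-1 * nsq y] smaller than [e]; the [+ 1] keeps [t] positive when [y = 0]. *)
pose t := (nsq y + 1) / e.
have t0 : 0 < t by rewrite divr_gt0// ltr_wpDl// nsq_ge0.
have [|n0 h] := ux (e / t); first by rewrite divr_gt0.
exists n0 => // n /= /h {}h; rewrite -rdotBl.
have te : t * nsq (u n - x) < e by rewrite -ltr_pdivlMl// mulrC.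
have y1 : t^-1 * nsq y < e.
  by rewrite invf_div mulrAC ltr_pdivrMr ?ltr_pM2l ?ltrDl// ltr_wpDl// nsq_ge0.
have := rdot_le_nsq (x - u n) y t0; have := rdot_le_nsq (u n - x) y t0.
have -> : rdot (u n - x) y = - rdot (x - u n) y by rewrite -rdotNl opprB.
by rewrite (nsqBC x) ltr_norml => a b; apply/andP; split; lra.
Qed.

Lemma scvg_nsq u x : scvg u x -> (fun n => nsq (u n)) @ \oo --> nsq x.
Proof.
move=> ux; have -> : (fun n => nsq (u n)) =
    (fun n => nsq (u n - x) + 2 * rdot (u n) x - nsq x).
  by apply/funext => n; rewrite nsqB; lra.
rewrite [X in _ --> X](_ : _ = 0 + 2 * rdot x x - nsq x); last by rewrite /nsq; lra.
apply: cvgB; last exact: cvg_cst.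
apply: cvgD; last by apply: cvgMr; exact: scvg_rdot.
apply/cvgrPdist_lt => e /ux[n0 h]; exists n0 => // n /= /h.
by rewrite sub0r normrN ger0_norm// nsq_ge0.
Qed.

(** A bounded monotone real sequence is Cauchy, and its increments dominate the squared distances.
    Orthogonal series and the Newton-Schulz iteration both converge by this criterion. *)
Lemma scvg_monotone u (r : nat -> R) (B : R) :
  (forall n, r n <= B) ->
  (forall n m, (n <= m)%N -> nsq (u m - u n) <= r m - r n) ->
  exists x, scvg u x.
Proof.
move=> rB ur; apply: scvg_cauchy => e e0.
have rnd : nondecreasing_seq r.
  move=> n m nm; rewrite -subr_ge0.
  by apply: le_trans (nsq_ge0 _) (ur _ _ nm).
have rc : cvgn r.
  by apply: nondecreasing_is_cvgn => //; exists B => _ [n _ <-].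
have/cvgrPdist_lt/(_ _ e0)[n0 _ h] := rc.
exists n0 => m n /andP[n0n nm]; apply: le_lt_trans (ur _ _ nm) _.
have rm := nondecreasing_cvgn_le rnd rc m.
have := h n n0n => /=; rewrite ger0_norm; first by lra.
by rewrite subr_ge0 nondecreasing_cvgn_le.
Qed.

End RealInner.

(** * Riesz representation and adjoints *)

Section LinearFun.
Variables (R : realType) (V W : lmodType R[i]) (T : V -> W).
Hypothesis lT : linear T.

Lemma linfunD x y : T (x + y) = T x + T y.
Proof. by have := lT 1 x y; rewrite !scale1r. Qed.

Lemma linfun0 : T 0 = 0.
Proof. by apply: (addrI (T 0)); rewrite -linfunD !addr0. Qed.

Lemma linfunZ a x : T (a *: x) = a *: T x.
Proof. by have := lT a x 0; rewrite linfun0 !addr0. Qed.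

Lemma linfunN x : T (- x) = - T x.
Proof. by rewrite -scaleN1r linfunZ scaleN1r. Qed.

Lemma linfunB x y : T (x - y) = T x - T y.
Proof. by rewrite linfunD linfunN. Qed.

Lemma linfun_sum I (r : seq I) (P : pred I) (F : I -> V) :
  T (\sum_(i <- r | P i) F i) = \sum_(i <- r | P i) T (F i).
Proof. exact: (big_morph T linfunD linfun0). Qed.

End LinearFun.

Section Bounded.
Variables (R : realType) (K1 K2 : hilbertType R) (T : K1 -> K2).
Hypothesis lT : linear T.

Let Tlin : {linear K1 -> K2} := HB.pack T (GRing.isLinear.Build _ _ _ _ T lT).

Lemma continuous_nsqP : continuous T <-> exists2 C : R, 0 < C &
  forall x, nsq (T x) <= C * nsq x.
Proof.
rewrite -[T in continuous T]/(Tlin : _ -> _) -linear_bounded_continuous linear_boundedP.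
split=> [/pinfty_ex_gt0 [_ /complex_pos[r r0 ->]] h|[C C0 h]].
  exists (r ^+ 2) => [|x]; first by rewrite exprn_gt0.
  rewrite -lecR rmorphM/= -!normsqE rmorphXn/= -exprMn.
  by rewrite lerXn2r ?nnegrE ?mulr_ge0 ?h// lecR ltW.
near=> r => x; rewrite -(ler_pXn2r (n := 2)) ?nnegrE//; last first.
  by rewrite mulr_ge0//; near: r; exact: nbhs_pinfty_ge.
have rC : (Num.sqrt C)%:C <= r.
  by near: r; apply: nbhs_pinfty_ge; rewrite ger0_real// lecR sqrtr_ge0.
rewrite exprMn; apply: (@le_trans _ _ (C%:C * `|x| ^+ 2)).
  by rewrite !normsqE -rmorphM lecR h.
have sC : 0 <= Num.sqrt C :> R by exact: sqrtr_ge0.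
rewrite ler_wpM2r ?exprn_ge0// -[C]sqr_sqrtr; last exact: ltW.
by rewrite rmorphXn/= lerXn2r ?nnegrE ?(le_trans _ rC) ?lecR.
Unshelve. all: by end_near. Qed.

Lemma scvg_linear (u : nat -> K1) x : continuous T ->
  scvg u x -> scvg (fun n => T (u n)) (T x).
Proof.
move=> /continuous_nsqP[C C0 h] ux e e0.
have [|n0 hn] := ux (e / C); first by rewrite divr_gt0.
exists n0 => n /hn; rewrite ltr_pdivlMr// mulrC -linfunB//.
exact: le_lt_trans.
Qed.

End Bounded.

Section Riesz.
Variables (R : realType) (K : hilbertType R) (f : K -> R) (B : R).
Hypothesis fD : {morph f : x y / x + y}.
Hypothesis fZ : forall (r : R) x, f (r%:C *: x) = r * f x.
Hypothesis f_bounded : forall x, 2 * f x <= nsq x + B.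

(** [f_bounded] says that [nsq x - 2 * f x] is bounded below. A minimising sequence is Cauchy by the
    parallelogram law, and the first variation at its limit represents [f]. *)
Lemma riesz : exists y, forall x, f x = rdot x y.
Proof.
pose F x := nsq x - 2 * f x.
have Flb : has_inf [set F x | x in [set: K]].
  split; first by exists (F 0), 0.
  by exists (- B) => _ [x _ <-]; rewrite /F; have := f_bounded x; lra.
set I := inf [set F x | x in [set: K]].
have FI x : I <= F x by apply: ge_inf; [exact: Flb.2|exists x].
have /choice[u uI] n : exists x, F x < I + n.+1%:R^-1.
  have [|_ [x _ <-] h] := @inf_adherent _ _ n.+1%:R^-1 _ Flb; last by exists x.
  by rewrite invr_gt0.
have upar x y : nsq (x - y) = 2 * F x + 2 * F y - 4 * F ((2^-1)%:C *: (x + y)).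
  by rewrite /F nsqZ fZ fD nsqB nsqD; field.
have inv_small (e : R) : 0 < e -> exists n0, forall n, (n0 <= n)%N -> n.+1%:R^-1 < e.
  move=> e0; have /cvgrPdist_lt/(_ e e0)[n0 _ h] := @cvg_harmonic R.
  by exists n0 => n /h; rewrite sub0r normrN ger0_norm// invr_ge0.
have [y uy] : exists y, scvg u y.
  apply: scvg_cauchy => e e0.
  have [|n0 h] := inv_small (e / 4); first by rewrite divr_gt0.
  exists n0 => m n /andP[n0n nm]; rewrite upar.
  have := h _ n0n; have := h _ (leq_trans n0n nm).
  have := FI ((2^-1)%:C *: (u m + u n)); have := uI m; have := uI n.
  by move: m.+1%:R^-1 n.+1%:R^-1 => d d'; lra.
exists y => z; rewrite rdotC.
(* Moving from the near-minimiser [u n] to [u n + s%:C *: z] lowers [F] by less than [n.+1%:R^-1];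
   let [n] grow. *)
have key (s : R) : 0 <= s ^+ 2 * nsq z + 2 * s * (rdot y z - f z).
  have c1 : (fun n => s ^+ 2 * nsq z + 2 * s * (rdot (u n) z - f z) + n.+1%:R^-1)
     @ \oo --> s ^+ 2 * nsq z + 2 * s * (rdot y z - f z) + 0.
    apply: cvgD; last exact: cvg_harmonic.
    apply: cvgD; first exact: cvg_cst.
    apply: cvgMr; apply: cvgB; last exact: cvg_cst.
    exact: scvg_rdot.
  rewrite -[X in _ <= X]addr0 -(cvg_lim _ c1)//.
  apply: limr_ge; first by apply/cvg_ex; eexists; exact: c1.
  near=> n; have := uI n; have := FI (u n + s%:C *: z).
  by rewrite /F nsqD nsqZ rdotZr fD fZ; move: n.+1%:R^-1 => d; lra.
set d := rdot y z - f z in key *; set c := nsq z in key.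
have c0 : 0 <= c by exact: nsq_ge0.
suff: d = 0 by rewrite /d; lra.
apply/eqP; rewrite -sqrf_eq0 eq_le sqr_ge0 andbT.
have c1 : 0 < c + 1 by lra.
(* The quadratic is smallest at [- d / c]; [c + 1] avoids a division by zero and still gives a
   negative value unless [d = 0]. *)
have := key (- d / (c + 1)).
have -> : (- d / (c + 1)) ^+ 2 * c + 2 * (- d / (c + 1)) * d =
  - (d ^+ 2) * ((c + 2) / (c + 1) ^+ 2) by field; rewrite gt_eqF.
by rewrite mulNr oppr_ge0 pmulr_lle0// divr_gt0 ?exprn_gt0//; lra.
Unshelve. all: by end_near. Qed.

End Riesz.

Section AdjointExists.
Variables (R : realType) (K1 K2 : hilbertType R) (T : K1 -> K2).
Hypotheses (lT : linear T) (cT : continuous T).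

Lemma hadjoint_exists : exists S : K2 -> K1,
  [/\ linear S, continuous S & forall x y, ⟪T x, y⟫ = ⟪x, S y⟫].
Proof.
have [C C0 hC] := (continuous_nsqP lT).1 cT.
have /choice[S TS] y : exists z, forall x, rdot (T x) y = rdot x z.
  apply: (@riesz _ _ (fun x => rdot (T x) y) (C * nsq y)) => [x x'|r x|x].
  - by rewrite linfunD// rdotDl.
  - by rewrite linfunZ// rdotZl.
  - have := @rdot_le_nsq _ _ C^-1 (T x) y; rewrite invr_gt0 invrK => /(_ C0).
    by move/le_trans; apply; rewrite lerD2r ler_pdivrMl.
have adj x y : ⟪T x, y⟫ = ⟪x, S y⟫ by rewrite !hinner_rdot TS -linfunZ// TS.
have lS : linear S.
  move=> a y y'; apply: rdot_ext => z; rewrite rdotC /rdot -adj hinnerDr hinnerZr.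
  by rewrite !adj -hinnerZr -hinnerDr -/(rdot _ _) rdotC.
exists S; split => //; apply/(continuous_nsqP lS); exists C => // y.
(* The weight [C^-1] absorbs [nsq (T (S y))] into [nsq (S y)], so the adjoint inherits the constant
   [C]. *)
have := @rdot_le_nsq _ _ C^-1 (T (S y)) y; rewrite invr_gt0 invrK TS => /(_ C0).
rewrite -[rdot (S y) _]/(nsq (S y)).
have : C^-1 * nsq (T (S y)) <= nsq (S y) by rewrite ler_pdivrMl.
by rewrite -[T (S y)]/(T (S y)); lra.
Qed.

End AdjointExists.

(** * The ring of bounded operators *)

(** Composition of arbitrary maps does not distribute over sums in its inner argument, so [K -> K]
    is no ring under it. Bundled bounded operators form one, and operator identities become ring
    computations. *)
Record bop (R : realType) (K : hilbertType R) := Bop {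
  bfun :> K -> K;
  bop_bounded : bounded_ops bfun
}.

Section BopRing.
Variables (R : realType) (K : hilbertType R).
Implicit Types (S T U x y z : bop K) (u v : K).

HB.instance Definition _ := gen_eqMixin (bop K).
HB.instance Definition _ := gen_choiceMixin (bop K).

Lemma bop_linear T : linear T. Proof. by case: (bop_bounded T). Qed.
Lemma bop_continuous T : continuous T. Proof. by case: (bop_bounded T). Qed.

Lemma bop_ext S T : S =1 T -> S = T.
Proof.
case: S T => S bS [T bT] /= /funext ST; rewrite ST in bS *.
by congr Bop; exact: Prop_irrelevance.
Qed.

Lemma bounded_ops0 : bounded_ops (0 : K -> K).
Proof.
by split=> [a u v|u]; [rewrite [RHS]addr0 [RHS]scaler0|exact: cvg_cst].
Qed.

Lemma bounded_ops_id : bounded_ops (@idfun K).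
Proof. by split=> // u; exact: cvg_id. Qed.

Lemma bounded_opsN T : bounded_ops (- (T : K -> K)).
Proof.
split=> [a u v|u]; last by apply: cvgN; exact: bop_continuous.
by rewrite /GRing.opp/= (bop_linear T) opprD scalerN.
Qed.

Lemma bounded_opsD S T : bounded_ops ((S : K -> K) + T).
Proof.
split=> [a u v|u]; last by apply: cvgD; exact: bop_continuous.
by rewrite /GRing.add/= (bop_linear S) (bop_linear T) scalerDr addrACA.
Qed.

Lemma bounded_opsM S T : bounded_ops ((S : K -> K) \o T).
Proof.
split=> [a u v /=|u]; first by rewrite (bop_linear T) (bop_linear S).
by apply: continuous_comp; exact: bop_continuous.
Qed.

Lemma bounded_opsZ (a : R[i]) T : bounded_ops (a *: (T : K -> K)).
Proof.
split=> [b u v|u]; last by apply: cvgZr; exact: bop_continuous.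
rewrite -[LHS]/(a *: T (b *: u + v)) (bop_linear T) scalerDr.
by rewrite -[(_ *: _) u]/(a *: T u) !scalerA mulrC.
Qed.

Definition bop0 := Bop bounded_ops0.
Definition bop1 := Bop bounded_ops_id.
Definition bopN T := Bop (bounded_opsN T).
Definition bopD S T := Bop (bounded_opsD S T).
Definition bopM S T := Bop (bounded_opsM S T).
Definition bopZ a T := Bop (bounded_opsZ a T).

Let bopDA : associative bopD.
Proof. by move=> S T U; apply: bop_ext => u; exact: addrA. Qed.
Let bopDC : commutative bopD.
Proof. by move=> S T; apply: bop_ext => u; exact: addrC. Qed.
Let bop0D : left_id bop0 bopD.
Proof. by move=> S; apply: bop_ext => u; exact: add0r. Qed.
Let bopND : left_inverse bop0 bopN bopD.
Proof. by move=> S; apply: bop_ext => u; exact: addNr. Qed.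

HB.instance Definition _ := GRing.isZmodule.Build (bop K) bopDA bopDC bop0D bopND.

Let bopMA : associative bopM. Proof. by move=> S T U; exact: bop_ext. Qed.
Let bop1M : left_id bop1 bopM. Proof. by move=> S; exact: bop_ext. Qed.
Let bopM1 : right_id bop1 bopM. Proof. by move=> S; exact: bop_ext. Qed.
Let bopMDl : left_distributive bopM bopD.
Proof. by move=> S T U; exact: bop_ext. Qed.
Let bopMDr : right_distributive bopM bopD.
Proof. by move=> S T U; apply: bop_ext => u; apply: linfunD; exact: bop_linear. Qed.

HB.instance Definition _ :=
  GRing.Zmodule_isPzRing.Build (bop K) bopMA bop1M bopM1 bopMDl bopMDr.

Let bopZA a b T : bopZ a (bopZ b T) = bopZ (a * b) T.
Proof. by apply: bop_ext => u; exact: scalerA. Qed.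
Let bop1Z : left_id 1 bopZ.
Proof. by move=> T; apply: bop_ext => u; exact: scale1r. Qed.
Let bopZDr : right_distributive bopZ bopD.
Proof. by move=> a S T; apply: bop_ext => u; exact: scalerDr. Qed.
Let bopZDl T : {morph bopZ^~ T : a b / a + b >-> bopD a b}.
Proof. by move=> a b; apply: bop_ext => u; exact: scalerDl. Qed.

HB.instance Definition _ :=
  GRing.Zmodule_isLmodule.Build R[i] (bop K) bopZA bop1Z bopZDr bopZDl.

Lemma bopZMl a S T : a *: (S * T) = (a *: S) * T. Proof. exact: bop_ext. Qed.
Lemma bopZMr a S T : a *: (S * T) = S * (a *: T).
Proof.
by apply: bop_ext => u; rewrite [RHS](linfunZ (@bop_linear S)).
Qed.

Lemma bop0E u : (0 : bop K) u = 0. Proof. by []. Qed.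
Lemma bop1E u : (1 : bop K) u = u. Proof. by []. Qed.
Lemma bopDE S T u : (S + T) u = S u + T u. Proof. by []. Qed.
Lemma bopNE T u : (- T) u = - T u. Proof. by []. Qed.
Lemma bopBE S T u : (S - T) u = S u - T u. Proof. by []. Qed.
Lemma bopME S T u : (S * T) u = S (T u). Proof. by []. Qed.
Lemma bopZE a T u : (a *: T) u = a *: T u. Proof. by []. Qed.
Definition bopE := (bop0E, bop1E, bopDE, bopNE, bopME, bopZE).

Lemma bop_sumE I (r : seq I) (P : pred I) (F : I -> bop K) u :
  (\sum_(i <- r | P i) F i) u = \sum_(i <- r | P i) F i u.
Proof. exact: (big_morph (fun T : bop K => T u)). Qed.

Lemma bop_lin0 T : T 0 = 0. Proof. by apply: linfun0; exact: bop_linear. Qed.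
Lemma bop_linD T u v : T (u + v) = T u + T v.
Proof. by apply: linfunD; exact: bop_linear. Qed.
Lemma bop_linB T u v : T (u - v) = T u - T v.
Proof. by apply: linfunB; exact: bop_linear. Qed.
Lemma bop_linZ T a u : T (a *: u) = a *: T u.
Proof. by apply: linfunZ; exact: bop_linear. Qed.

Lemma bop_rdot S T : (forall u v, rdot (S u) v = rdot (T u) v) -> S = T.
Proof. by move=> ST; apply: bop_ext => u; exact: rdot_ext. Qed.

Lemma star_exists T : exists S : bop K, is_adjoint T S.
Proof.
have [S [lS cS TS]] := hadjoint_exists (bop_linear T) (@bop_continuous T).
by exists (Bop (conj lS cS)).
Qed.

Definition star T : bop K := projT1 (cid (star_exists T)).

Local Notation "x ^†" := (star x) (at level 2, format "x ^†").

Lemma star_is_adjoint T : is_adjoint T (T^†).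
Proof. by rewrite /star; case: cid. Qed.

Lemma starP T u v : rdot (T u) v = rdot u (T^† v).
Proof. by rewrite /rdot star_is_adjoint. Qed.

Lemma starPr T u v : rdot (T^† u) v = rdot u (T v).
Proof. by rewrite rdotC -starP rdotC. Qed.

Lemma star_uniq S T : (forall u v, rdot (S u) v = rdot u (T v)) -> S^† = T.
Proof. by move=> ST; apply: bop_rdot => u v; rewrite starPr rdotC ST rdotC. Qed.

Lemma is_adjoint_star S T : is_adjoint S T -> S^† = T.
Proof. by move=> ST; apply: star_uniq => u v; rewrite /rdot ST. Qed.

Lemma starK : involutive star.
Proof. by move=> T; apply: star_uniq => u v; rewrite starPr. Qed.
Lemma star0 : 0^† = 0.
Proof. by apply: star_uniq => u v; rewrite rdot0l rdot0r. Qed.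
Lemma star1 : 1^† = 1. Proof. exact: star_uniq. Qed.
Lemma starN T : (- T)^† = - T^†.
Proof. by apply: star_uniq => u v; rewrite rdotNl rdotNr starP. Qed.
Lemma starD S T : (S + T)^† = S^† + T^†.
Proof. by apply: star_uniq => u v; rewrite rdotDl rdotDr !starP. Qed.
Lemma starB S T : (S - T)^† = S^† - T^†.
Proof. by rewrite starD starN. Qed.
Lemma starM S T : (S * T)^† = T^† * S^†.
Proof. by apply: star_uniq => u v; rewrite bopME !starP. Qed.
Lemma starZ (r : R) T : (r%:C *: T)^† = r%:C *: T^†.
Proof. by apply: star_uniq => u v; rewrite rdotZl rdotZr starP. Qed.
Lemma nsq_star T u : nsq (T u) = rdot ((T^† * T) u) u.
Proof. by rewrite bopME starPr. Qed.

Lemma star_mul0 S T : S^† * T = 0 <-> T^† * S = 0.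
Proof. by split=> /(congr1 star); rewrite !(starM, starK, star0). Qed.

Lemma star_mulr_eq0 S T : S * T = 0 <-> T^† * S^† = 0.
Proof.
by split=> /(congr1 star); rewrite !(starM, starK) star0.
Qed.

Lemma star_mul_self T : T^† * T = 0 -> T = 0.
Proof.
move=> T0; apply: bop_ext => u; apply: nsq_eq0.
by rewrite nsq_star T0 rdot0l.
Qed.

Lemma bop_boundP T : exists2 C : R, 0 < C & forall u, nsq (T u) <= C * nsq u.
Proof.
exact: (continuous_nsqP (bop_linear T)).1 (@bop_continuous T).
Qed.

Definition contractive T := forall u, nsq (T u) <= nsq u.

Lemma contractive_star T : contractive T -> contractive T^†.
Proof.
move=> cT u; have := rdot_le_nsq (T (T^† u)) u (@ltr01 R).
rewrite starP -/(nsq _) invr1; have := cT (T^† u); lra.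
Qed.

Lemma contractiveM S T : contractive S -> contractive T -> contractive (S * T).
Proof. by move=> cS cT u; apply: le_trans (cS _) (cT _). Qed.

Definition is_proj T := T^† = T /\ T * T = T.

Lemma proj_nsq T u : is_proj T -> nsq (T u) = rdot (T u) u.
Proof. by move=> [aT TT]; rewrite nsq_star aT TT. Qed.

Lemma is_projC T : is_proj T -> is_proj (1 - T).
Proof.
move=> [aT TT]; split; first by rewrite starB star1 aT.
by rewrite mulrBr mulr1 mulrBl mul1r TT subrr subr0.
Qed.

Lemma proj_contractive T : is_proj T -> contractive T.
Proof.
move=> pT u; have := nsq_ge0 ((1 - T) u).
by rewrite (proj_nsq _ (is_projC pT)) !bopE rdotBl (proj_nsq u pT) /nsq; lra.
Qed.

Lemma is_projD S T : is_proj S -> is_proj T -> S * T = 0 -> is_proj (S + T).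
Proof.
move=> [aS SS] [aT TT] ST; have TS : T * S = 0 by rewrite -aS -aT -starM ST star0.
by split; [rewrite starD aS aT|rewrite mulrDl !mulrDr SS TT ST TS addr0 add0r].
Qed.

Lemma scvg_bop T (w : nat -> K) v : scvg w v -> scvg (fun n => T (w n)) (T v).
Proof. by apply: scvg_linear; [exact: bop_linear|exact: bop_continuous]. Qed.

Definition sotcvg (Tn : nat -> bop K) T := forall u, scvg (fun n => Tn n u) (T u).

Lemma sotcvg_uniq Tn S T : sotcvg Tn S -> sotcvg Tn T -> S = T.
Proof.
by move=> TS TT; apply: bop_ext => u; exact: scvg_uniq (TS u) (TT u).
Qed.

Lemma sotcvg_cst T : sotcvg (fun=> T) T.
Proof. by move=> u; exact: scvg_cst. Qed.

Lemma sotcvgD Sn Tn S T : sotcvg Sn S -> sotcvg Tn T ->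
  sotcvg (fun n => Sn n + Tn n) (S + T).
Proof. by move=> SS TT u; apply: scvgD; [exact: SS|exact: TT]. Qed.

Lemma sotcvgZ a Tn T : sotcvg Tn T -> sotcvg (fun n => a *: Tn n) (a *: T).
Proof. by move=> TT u; have := scvg_bop (bopZ a bop1) (TT u). Qed.

Lemma sotcvgB Sn Tn S T : sotcvg Sn S -> sotcvg Tn T ->
  sotcvg (fun n => Sn n - Tn n) (S - T).
Proof.
move=> SS TT u; apply: scvgD (SS u) _.
by have := scvg_bop (bopN bop1) (TT u).
Qed.

Lemma sotcvgMl S Tn T : sotcvg Tn T -> sotcvg (fun n => S * Tn n) (S * T).
Proof. by move=> TT u; apply: scvg_bop; exact: TT. Qed.

Lemma sotcvgMr S Tn T : sotcvg Tn T -> sotcvg (fun n => Tn n * S) (T * S).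
Proof. by move=> TT u; exact: TT. Qed.

Lemma sotcvg_shift Tn T : sotcvg Tn T -> sotcvg (fun n => Tn n.+1) T.
Proof. by move=> TT u; exact: (scvg_shift (TT u)). Qed.

Lemma sotcvgM Sn Tn S T : (forall n, contractive (Sn n)) ->
  sotcvg Sn S -> sotcvg Tn T -> sotcvg (fun n => Sn n * Tn n) (S * T).
Proof.
move=> cS SS TT u e e0; have e4 : 0 < e / 4 by rewrite divr_gt0.
have [n1 h1] := TT u _ e4; have [n2 h2] := SS (T u) _ e4.
exists (maxn n1 n2) => n; rewrite geq_max => /andP[/h1 {}h1 /h2 {}h2].
have -> : (Sn n * Tn n) u - (S * T) u =
    Sn n (Tn n u - T u) + (Sn n (T u) - S (T u)).
  by rewrite bop_linB addrA subrK.
have := nsqD_le (Sn n (Tn n u - T u)) (Sn n (T u) - S (T u)).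
by have := cS n (Tn n u - T u); lra.
Qed.

Lemma sotcvg_rdot Tn T u v : sotcvg Tn T ->
  (fun n => rdot (Tn n u) v) @ \oo --> rdot (T u) v.
Proof. by move=> TT; apply: scvg_rdot; exact: TT. Qed.

(** Taking adjoints is not strongly continuous, so convergence of the adjoints is a hypothesis of
    its own; the two limits are then matched weakly. *)
Lemma sotcvg_star Sn S T : sotcvg Sn S -> sotcvg (fun n => (Sn n)^†) T -> S^† = T.
Proof.
move=> SS ST; apply: star_uniq => u v.
have := sotcvg_rdot (u := v) (v := u) ST; rewrite (rdotC (T v)).
have -> : (fun n => rdot ((Sn n)^† v) u) = (fun n => rdot (Sn n u) v).
  by apply/funext => n; rewrite starPr rdotC.
by move=> /cvg_lim<-//; have /cvg_lim<- := sotcvg_rdot (u := u) (v := v) SS.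
Qed.

Lemma sot_limit (Tn : nat -> bop K) (C : R) : 0 < C ->
  (forall n u, nsq (Tn n u) <= C * nsq u) ->
  (forall u, exists v, scvg (fun n => Tn n u) v) ->
  exists2 T, sotcvg Tn T & forall u, nsq (T u) <= C * nsq u.
Proof.
move=> C0 TC /choice[T TT].
have bT u : nsq (T u) <= C * nsq u.
  rewrite -(cvg_lim _ (scvg_nsq (TT u)))//.
  apply: limr_le; first by apply/cvg_ex; eexists; exact: scvg_nsq (TT u).
  by near=> n; exact: TC.
have lT : linear T.
  move=> a u v; apply: scvg_uniq (TT _) _.
  apply: (@eq_scvg _ _ (fun n => a *: Tn n u + Tn n v)) => [n|].
    by rewrite bop_linD bop_linZ.
  by apply: scvgD (TT v); have := scvg_bop (bopZ a bop1) (TT u).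
have bdT : bounded_ops T by split=> //; apply/continuous_nsqP => //; exists C.
by exists (Bop bdT).
Unshelve. all: by end_near. Qed.

(** The closure properties of a von Neumann algebra on which the constructions rely. Sequential
    strong closure suffices, since every limit formed in the algebra is that of a sequence. *)
Record vN_set (A : set (bop K)) : Prop := VNSet {
  vN1 : A 1;
  vND : forall S T, A S -> A T -> A (S + T);
  vNM : forall S T, A S -> A T -> A (S * T);
  vNZ : forall a T, A T -> A (a *: T);
  vNstar : forall T, A T -> A (T^†);
  vNlim : forall Tn T, (forall n, A (Tn n)) -> sotcvg Tn T -> A T
}.

Section VNset.
Variables (A : set (bop K)) (vA : vN_set A).

Lemma vN0 : A 0.
Proof. by rewrite -(scale0r (1 : bop K)); apply: (vNZ vA); exact: (vN1 vA). Qed.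

Lemma vNN T : A T -> A (- T).
Proof. by move=> AT; rewrite -scaleN1r; exact: (vNZ vA). Qed.

Lemma vNB S T : A S -> A T -> A (S - T).
Proof. by move=> AS AT; apply: (vND vA) => //; exact: vNN. Qed.

Lemma vN_sum I (r : seq I) (P : pred I) (F : I -> bop K) :
  (forall i, A (F i)) -> A (\sum_(i <- r | P i) F i).
Proof. by move=> AF; elim/big_ind: _ => //; [exact: vN0|exact: (vND vA)]. Qed.

End VNset.

End BopRing.

Notation "x ^†" := (star x) (at level 2, format "x ^†").

(** * Orthogonal series and the polar decomposition *)

Lemma sotcvg_series_single (R : realType) (K : hilbertType R) (z : nat -> bop K)
    (S Z : bop K) k :
  (forall j, j != k -> S * z j = 0) -> sotcvg (fun n => \sum_(j < n) z j) Z ->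
  S * Z = S * z k.
Proof.
move=> Sz zZ; apply: sotcvg_uniq (sotcvgMl S zZ) _ => u.
apply: (scvg_ev (n0 := k.+1) (u := fun=> (S * z k) u)); last exact: scvg_cst.
move=> n kn; congr (bfun _ u).
rewrite mulr_sumr (bigD1 (Ordinal kn))//= big1 ?addr0// => j jk.
exact: Sz.
Qed.

Section OrthogonalSeries.
Variables (R : realType) (K : hilbertType R) (z : nat -> bop K) (C : R).
Hypothesis C0 : 0 < C.
Hypothesis z_orth : forall j k, (j < k)%N -> (z j)^† * z k = 0.
Hypothesis z_bound : forall n u, \sum_(j < n) nsq (z j u) <= C * nsq u.

Let z_rdot n m u : (n <= m)%N -> rdot ((\sum_(j < n) z j) u) (z m u) = 0.
Proof.
move=> nm; rewrite bop_sumE rdot_suml big1// => j _.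
by rewrite starP -bopME z_orth ?rdot0r// (leq_trans (ltn_ord j)).
Qed.

Let nsq_series n u : nsq ((\sum_(j < n) z j) u) = \sum_(j < n) nsq (z j u).
Proof.
elim: n => [|n ih]; first by rewrite !big_ord0 nsq0.
by rewrite !big_ord_recr/= nsqD ih z_rdot// mulr0 addr0.
Qed.

(** The ranges of the [z j] are pairwise orthogonal, so by Pythagoras the squared norms of the
    partial sums form a bounded monotone sequence. *)
Lemma orthogonal_series : exists2 Z,
  sotcvg (fun n => \sum_(j < n) z j) Z & forall u, nsq (Z u) <= C * nsq u.
Proof.
apply: sot_limit => // [n u|u]; first by rewrite nsq_series.
apply: (@scvg_monotone _ _ _ (fun n => \sum_(j < n) nsq (z j u)) (C * nsq u)) => //.
move=> n m nm; rewrite nsqB !nsq_series.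
suff -> : rdot ((\sum_(j < m) z j) u) ((\sum_(j < n) z j) u) =
  \sum_(j < n) nsq (z j u) by lra.
elim: m nm => [|m ih]; first by rewrite leqn0 => /eqP->; rewrite !big_ord0 rdot0l.
rewrite leq_eqVlt => /predU1P[->|nm]; first by rewrite -nsq_series.
by rewrite big_ord_recr/= rdotDl ih// [X in _ + X]rdotC z_rdot// addr0.
Qed.

Lemma orthogonal_series_star Z k : sotcvg (fun n => \sum_(j < n) z j) Z ->
  (z k)^† * Z = (z k)^† * z k.
Proof.
move=> zZ; apply: (sotcvg_series_single _ zZ) => j.
case: (ltngtP j k) => // [jk _|kj _]; last by rewrite z_orth.
by apply/star_mul0; rewrite z_orth.
Qed.

End OrthogonalSeries.

Section Polar.
Variables (R : realType) (K : hilbertType R).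
Implicit Types (x b T S : bop K) (u v : K).

(* Each element of the cone commutes with [b] and is positive as soon as
   0 <= b <= 1, without any appeal to square roots. *)
Inductive cone b : bop K -> Prop :=
| cone1 : cone b 1
| coneX T : cone b T -> cone b (b * T)
| coneC T : cone b T -> cone b ((1 - b) * T)
| coneD S T : cone b S -> cone b T -> cone b (S + T)
| coneZ (r : R) T : 0 <= r -> cone b T -> cone b (r%:C *: T).

Lemma cone0 b : cone b 0.
Proof.
have := coneZ (lexx 0) (cone1 b).
by rewrite [X in X *: _](_ : _ = 0)// scale0r.
Qed.

Lemma coneM b S T : cone b S -> cone b T -> cone b (S * T).
Proof.
move=> + bT; elim=> [|{}S _ ih|{}S _ ih|S1 S2 _ ih1 _ ih2|r {}S r0 _ ih].
- by rewrite mul1r.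
- by rewrite -mulrA; exact: coneX.
- by rewrite -mulrA; exact: coneC.
- by rewrite mulrDl; exact: coneD.
- by rewrite -bopZMl; exact: coneZ.
Qed.

Lemma cone_comm b S T : GRing.comm b S -> cone b T -> GRing.comm T S.
Proof.
move=> bS; elim=> [|{}T _ ih|{}T _ ih|T1 T2 _ ih1 _ ih2|r {}T r0 _ ih].
- exact/commr_sym/commr1.
- by apply/commr_sym/commrM; exact/commr_sym.
- apply/commr_sym/commrM; last exact/commr_sym.
  by apply: commrB; [exact: commr1|exact: commr_sym].
- by apply/commr_sym/commrD; exact/commr_sym.
- by rewrite /GRing.comm -bopZMl -bopZMr ih.
Qed.

Section Positive.
Variable b : bop K.
Hypothesis b_star : b^† = b.

Lemma cone_commb T : cone b T -> b * T = T * b.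
Proof. by move=> /(cone_comm (commr_refl b)). Qed.

Lemma cone_star T : cone b T -> T^† = T.
Proof.
elim=> [|{}T cT ih|{}T cT ih|T1 T2 _ ih1 _ ih2|r {}T r0 _ ih].
- exact: star1.
- by rewrite starM ih b_star -cone_commb.
- rewrite starM ih starB star1 b_star mulrBl mulrBr mul1r mulr1.
  by rewrite -cone_commb.
- by rewrite starD ih1 ih2.
- by rewrite starZ ih.
Qed.

Let pos T := forall u, 0 <= rdot (T u) u.

Hypotheses (b_pos : pos b) (bC_pos : pos (1 - b)) (bbC_pos : pos (b * (1 - b))).

Let sandwich S T : S^† = S -> S * T = T * S -> pos T -> pos (S * (S * T)).
Proof. by move=> aS ST pT u; rewrite bopME starP aS ST; exact: pT. Qed.

(** Positivity of [T] alone is not inductive. The products of [T] with 1, [b], [1 - b] and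
    [b * (1 - b)] are permuted by a further factor [b] or [1 - b], up to squares of these, which
    [sandwich] absorbs. *)
Lemma cone_pos T : cone b T -> pos T.
Proof.
have bC_star : (1 - b)^† = 1 - b by rewrite starB star1 b_star.
move=> cT; suff [] : [/\ pos T, pos (b * T), pos ((1 - b) * T) &
  pos (b * ((1 - b) * T))] by [].
have bbC : b * (1 - b) = (1 - b) * b by rewrite mulrBl mulrBr mul1r mulr1.
elim: cT => [|{}T cT [h1 h2 h3 h4]|{}T cT [h1 h2 h3 h4]|T1 T2 _ [? ? ? ?] _ [? ? ? ?]|
    r {}T r0 _ [h1 h2 h3 h4]].
- by rewrite !mulr1; split=> // u; exact: nsq_ge0.
- have bT := cone_commb cT; have bCT := cone_commb (coneC cT).
  split=> //.
  + exact: sandwich.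
  + by rewrite mulrA -bbC -mulrA.
  + by rewrite [_ * (b * T)]mulrA -bbC -mulrA; exact: sandwich.
- have bT : (1 - b) * T = T * (1 - b).
    by rewrite mulrBl mulrBr mul1r mulr1 cone_commb.
  split=> //; first exact: sandwich.
  have -> : b * ((1 - b) * ((1 - b) * T)) = (1 - b) * ((1 - b) * (b * T)).
    by rewrite !mulrA bbC -(mulrA _ b) bbC !mulrA.
  by apply: sandwich => //; rewrite mulrA -bbC -!mulrA bT.
- by split=> u; rewrite ?mulrDr bopDE rdotDl addr_ge0.
- by split=> u; rewrite -?bopZMr bopZE rdotZl mulr_ge0.
Qed.

End Positive.

Section Iteration.
Variable x : bop K.

(* Newton-Schulz iteration x_(n+1) = x_n (3 - x_n^* x_n) / 2, with x_n = x f_n. *)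
Fixpoint nsf b n : bop K := if n is n'.+1 then
  nsf b n' + nsf b n' * ((2^-1)%:C *: (1 - b * (nsf b n' * nsf b n'))) else 1.

Definition nsx n := x * nsf (x^† * x) n.

End Iteration.

(** With [g = b * (f * f)], the increment of [f] is [f] times half of [1 - g]. Everything thus
    follows from membership of [f] and of [1 - g], proved in one induction. *)
Lemma nsf_cone b n : [/\ cone b (nsf b n), cone b (b * (nsf b n * nsf b n)),
   cone b (1 - b * (nsf b n * nsf b n)) & cone b (nsf b n.+1 - nsf b n)].
Proof.
suff [h1 h2] : cone b (nsf b n) /\ cone b (1 - b * (nsf b n * nsf b n)).
  split=> //; first exact/coneX/coneM.
  rewrite /= [X in cone b X]addrC addrA addNr add0r.
  by apply: coneM => //; apply: coneZ => //; rewrite invr_ge0.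
elim: n => [|n [ihf ihb]].
  by split; [exact: cone1|rewrite /= !mulr1 -[1 - b]mulr1; exact: coneC (cone1 b)].
set f := nsf b n in ihf ihb *; set d := (2^-1)%:C *: (1 - b * (f * f)).
have cd : cone b d by apply: coneZ; rewrite ?invr_ge0.
have cfd : cone b (f + f * d) by apply: coneD => //; exact: coneM.
rewrite /= -/f -/d; split => //.
have comm S T : cone b S -> cone b T -> S * T = T * S.
  move=> cS cT; apply/(@cone_comm b) => //; apply/commr_sym.
  by apply: (@cone_comm b) => //; exact: commr_refl.
(* Since [b * (f * f)] is [1 - 2 d], the new defect is [1 - (1 - 2 d)(1 + d)^2 = 3 d^2 + 2 d^3],
   whose coefficients are nonnegative. *)
have -> : 1 - b * ((f + f * d) * (f + f * d)) =
    3%:C *: (d * d) + 2%:C *: (d * (d * d)).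
  have fd : f + f * d = f * (1 + d) by rewrite mulrDr mulr1.
  have cg : cone b (1 + d) by exact: coneD (cone1 b) cd.
  have -> : b * ((f + f * d) * (f + f * d)) = (b * (f * f)) * ((1 + d) * (1 + d)).
    by rewrite fd -!mulrA; do 2 congr (_ * _); rewrite mulrA -(comm f)// -mulrA.
  have -> : b * (f * f) = 1 - 2%:C *: d.
    rewrite /d scalerA -rmorphM/= divff ?pnatr_eq0// scale1r.
    by rewrite opprD opprK addrA subrr add0r.
  rewrite !(mulrDr, mulrDl, mulr1, mul1r, mulNr) -!bopZMl -?mulrA.
  apply: bop_rdot => u v.
  by rewrite !(bopDE, bopNE, rdotDl, rdotNl, bopZE, rdotZl); lra.
by apply: coneD; apply: coneZ; rewrite ?ler0n//; do ![exact: cd|apply: coneM].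
Qed.

(** An instance of x h(x^† x) = h(x x^†) x for polynomials h. It identifies [(nsx x n)^†] with the
    iterate of [x^†], and shows that every iterate vanishes on the kernel of [x]. *)
Lemma nsf_intertwine x n : x * nsf (x^† * x) n = nsf (x * x^†) n * x.
Proof.
elim: n => [|n ih]; first by rewrite /= mulr1 mul1r.
rewrite /= mulrDr mulrDl ih; congr (_ + _).
rewrite mulrA ih -!mulrA; congr (_ * _).
rewrite -bopZMr -bopZMl; congr (_ *: _).
rewrite mulrBr mulrBl mulr1 mul1r; congr (_ - _).
by rewrite -!mulrA -ih [nsf _ n * (x * _)]mulrA -ih -!mulrA.
Qed.

Section PolarDecomposition.
Variables (x : bop K) (x_contr : contractive x).
Let b := x^† * x.

Let b_star : b^† = b. Proof. by rewrite /b starM starK. Qed.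

Let b_pos u : 0 <= rdot (b u) u.
Proof. by rewrite -nsq_star nsq_ge0. Qed.

Let bC_pos u : 0 <= rdot ((1 - b) u) u.
Proof. by rewrite !bopE rdotBl -nsq_star subr_ge0 x_contr. Qed.

Let bbC_pos u : 0 <= rdot ((b * (1 - b)) u) u.
Proof.
(* In this form positivity comes from [1 - x * x^†], as [x^†] is a contraction too. *)
have -> : b * (1 - b) = x^† * ((1 - x * x^†) * x).
  by rewrite /b !(mulrBr, mulrBl) mul1r mulr1 !mulrA.
rewrite bopME starPr !bopE rdotBl subr_ge0 starP -!/(nsq _).
exact: contractive_star.
Qed.

Let pos T u : cone b T -> 0 <= rdot (T u) u.
Proof. by move=> cT; exact: (cone_pos b_star b_pos bC_pos bbC_pos cT). Qed.

Let f := nsf b.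

Let f_star n : (f n)^† = f n.
Proof. by apply: (cone_star b_star); have [] := nsf_cone b n. Qed.

Lemma nsx_star n : (nsx x n)^† = nsx x^† n.
Proof.
by rewrite /nsx starM f_star nsf_intertwine starK.
Qed.

Let nsx_gram n : (nsx x n)^† * nsx x n = b * (f n * f n).
Proof.
have [cf _ _ _] := nsf_cone b n.
by rewrite /nsx starM f_star -mulrA (mulrA x^†) -/b mulrA -(cone_commb cf) mulrA.
Qed.

Let nsx_nsq n u : nsq (nsx x n u) = rdot ((b * (f n * f n)) u) u.
Proof. by rewrite nsq_star nsx_gram. Qed.

(** The recursion solved for its cubic term. In the limit the right side becomes [w], so the limit
    is a partial isometry. *)
Lemma nsx_cube n : nsx x n * (nsx x n)^† * nsx x n =
  3%:C *: nsx x n - 2%:C *: nsx x n.+1.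
Proof.
rewrite -mulrA nsx_gram; set g := b * (f n * f n).
have -> : nsx x n.+1 = nsx x n + (2^-1)%:C *: (nsx x n - nsx x n * g).
  rewrite -[LHS]/(x * (f n + f n * ((2^-1)%:C *: (1 - g)))) mulrDr mulrA.
  by rewrite -[x * f n]/(nsx x n) -bopZMr mulrBr mulr1.
apply: bop_rdot => u v.
by rewrite !(bopDE, bopNE, rdotDl, rdotNl, bopZE, rdotZl); lra.
Qed.

Lemma nsx_contractive n : contractive (nsx x n).
Proof.
move=> u; rewrite nsx_nsq -subr_ge0 -rdotBl -[u in u - _]/((1 : bop K) u) -bopBE.
by apply: pos; have [] := nsf_cone b n.
Qed.

(** [f m - f n] lies in the cone, hence so does [b * (f n * (f m - f n))]. Its positivity bounds the
    cross term of the expanded square below by [nsq (nsx x n u)]. *)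
Lemma nsx_monotone n m u : (n <= m)%N ->
  nsq (nsx x m u - nsx x n u) <= nsq (nsx x m u) - nsq (nsx x n u).
Proof.
move=> nm; rewrite nsqB.
suff : nsq (nsx x n u) <= rdot (nsx x m u) (nsx x n u) by lra.
have cfm : cone b (f m - f n).
  elim: m nm => [|m ih].
    by rewrite leqn0 => /eqP->; rewrite subrr; exact: cone0.
  rewrite leq_eqVlt => /predU1P[->|nm].
    by rewrite subrr; exact: cone0.
  have -> : f m.+1 - f n = (f m.+1 - f m) + (f m - f n) by rewrite addrA subrK.
  by apply: coneD (ih nm); have [] := nsf_cone b m.
have [cf _ _ _] := nsf_cone b n.
rewrite -subr_ge0 /nsq -rdotBl -bopBE -mulrBr -starPr -bopME.
have -> : (nsx x n)^† * (x * (f m - f n)) = b * (f n * (f m - f n)).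
  by rewrite /nsx starM f_star -mulrA (mulrA x^†) -/b mulrA -(cone_commb cf) mulrA.
by apply/pos/coneX/coneM.
Qed.

Lemma nsx_cvg u : exists v, scvg (fun n => nsx x n u) v.
Proof.
apply: (@scvg_monotone _ _ _ (fun n => nsq (nsx x n u)) (nsq u)) => [n|n m].
  exact: nsx_contractive.
exact: nsx_monotone.
Qed.

End PolarDecomposition.

(* [w] is the isometric part of [x]: the kernels determine its initial and final
   projections. *)
Lemma polar (A : set (bop K)) x : vN_set A -> A x -> contractive x ->
  exists w, [/\ A w, w * w^† * w = w, forall u, x u = 0 <-> w u = 0
    & forall u, x^† u = 0 <-> w^† u = 0].
Proof.
move=> vA Ax cx; have cx' := contractive_star cx.
have [w xw _] := sot_limit (@ltr01 R)
  (fun n u => eq_ind_r (fun r => _ <= r) (nsx_contractive cx n u) (mul1r _))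
  (nsx_cvg cx).
have [w' xw' _] := sot_limit (@ltr01 R)
  (fun n u => eq_ind_r (fun r => _ <= r) (nsx_contractive cx' n u) (mul1r _))
  (nsx_cvg cx').
have ww' : w^† = w'.
  apply: sotcvg_star xw _ => u; have := xw' u.
  by apply: eq_scvg => n; rewrite nsx_star.
(* By intertwining, each iterate is an operator applied after [y], so it vanishes where [y] does.
   Conversely [nsq (nsx y n u)] increases from [nsq (y u)], so a zero limit forces [y u = 0]. *)
have ker y z : contractive y -> sotcvg (nsx y) z -> forall u, y u = 0 <-> z u = 0.
  move=> cy yz u; have mono := nsx_monotone cy u.
  have y0 : nsx y 0 = y by rewrite /nsx /= mulr1.
  split=> [yu|zu].
    apply: scvg_uniq (yz u) _; apply: eq_scvg (scvg_cst 0) => n.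
    by rewrite /nsx nsf_intertwine bopME yu bop_lin0.
  apply: nsq_eq0; apply/eqP; rewrite eq_le nsq_ge0 andbT.
  rewrite -[X in _ <= X](@nsq0 _ K) -zu -{1}y0.
  have c := scvg_nsq (yz u).
  rewrite -(cvg_lim _ c)//.
  apply: (nondecreasing_cvgn_le (u_ := fun n => nsq (nsx y n u))); last first.
    by apply/cvg_ex; eexists; exact: c.
  move=> n m nm; rewrite -subr_ge0; apply: le_trans (mono _ _ nm); exact: nsq_ge0.
exists w; split; last first.
- by rewrite ww'; exact: ker.
- exact: ker.
- have lim1 : sotcvg (fun n => nsx x n * (nsx x n)^† * nsx x n) (w * w^† * w).
    apply: sotcvgM (xw); first by move=> n; rewrite nsx_star//;
      apply: contractiveM; exact: nsx_contractive.
    rewrite ww'; apply: sotcvgM => //; first exact: nsx_contractive.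
    by move=> u; apply: eq_scvg (xw' u) => n; rewrite nsx_star.
  apply: sotcvg_uniq lim1 _.
  have lim2 : sotcvg (fun n => nsx x n + 2%:C *: (nsx x n - nsx x n.+1))
      (w + 2%:C *: (w - w)).
    apply: sotcvgD => //; apply: sotcvgZ; apply: sotcvgB => //.
    exact: sotcvg_shift.
  rewrite subrr scaler0 addr0 in lim2.
  move=> u; apply: eq_scvg (lim2 u) => n.
  rewrite nsx_cube; congr (bfun _ u); apply: bop_rdot => v z.
  by rewrite !(bopDE, bopNE, rdotDl, rdotNl, bopZE, rdotZl); lra.
- apply: vNlim (xw) => // n; apply: vNM => //.
  have Ab : A (x^† * x) by apply: vNM => //; exact: vNstar.
  elim: n => [|n ih]; first exact: vN1.
  apply: vND => //; apply: vNM => //; apply: vNZ => //; apply: vNB => //.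
    exact: vN1.
  by apply: vNM => //; exact: vNM.
Qed.

End Polar.

(** * Isometries with prescribed range complement *)

Section OrthogonalProjections.
Variables (R : realType) (K : hilbertType R) (p : nat -> bop K).
Hypothesis p_proj : forall j, is_proj (p j).
Hypothesis p_orth : forall j k, (j < k)%N -> p j * p k = 0.

Let sum_proj n : is_proj (\sum_(j < n) p j).
Proof.
elim: n => [|n ih]; first by rewrite big_ord0; split; rewrite ?star0 ?mul0r.
rewrite big_ord_recr /=; apply: is_projD => //.
by rewrite mulr_suml big1// => j _; exact: p_orth.
Qed.

Lemma bessel n u : \sum_(j < n) nsq (p j u) <= nsq u.
Proof.
suff -> : \sum_(j < n) nsq (p j u) = nsq ((\sum_(j < n) p j) u).
  exact: proj_contractive.
rewrite proj_nsq// bop_sumE rdot_suml; apply: eq_bigr => j _.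
exact: proj_nsq.
Qed.

Lemma orthogonal_projections : exists2 P,
  sotcvg (fun n => \sum_(j < n) p j) P & is_proj P.
Proof.
have [||P pP _] := @orthogonal_series _ _ p 1 ltr01.
- by move=> j k jk; rewrite (p_proj j).1 p_orth.
- by move=> n u; rewrite mul1r bessel.
exists P => //; split.
  by apply: sotcvg_star (pP) _ => u; apply: eq_scvg (pP u) => n; rewrite (sum_proj n).1.
have PP : sotcvg (fun n => (\sum_(j < n) p j) * (\sum_(j < n) p j)) (P * P).
  by apply: sotcvgM => // n; exact: proj_contractive.
by apply: sotcvg_uniq PP _ => u; apply: eq_scvg (pP u) => n; rewrite (sum_proj n).2.
Qed.

End OrthogonalProjections.

Section HilbertHotel.
Variables (R : realType) (K : hilbertType R) (A : set (bop K)).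
Hypothesis vA : vN_set A.

(* Shift along the orthogonal copies t^n p t^*n of p. *)
Lemma hilbert_hotel p t : is_proj p -> A p -> A t -> t^† * t = 1 -> p * t = 0 ->
  exists s, [/\ A s, s^† * s = 1 & s * s^† = 1 - p].
Proof.
move=> [p_star pp] Ap At tt pt.
have tp : t^† * p = 0 by rewrite -p_star -starM pt star0.
pose c j := t ^+ j * p * (t^†) ^+ j.
have tX j : (t^†) ^+ j * t ^+ j = 1.
  elim: j => [|j ih]; first by rewrite !expr0 mulr1.
  by rewrite exprSr exprS mulrA -(mulrA _ t^†) tt mulr1.
have starX j : (t ^+ j)^† = (t^†) ^+ j.
  by elim: j => [|j ih]; rewrite ?expr0 ?star1// exprS exprSr starM ih.
have starX' j : ((t^†) ^+ j)^† = t ^+ j by rewrite -starX starK.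
have cp j : is_proj (c j).
  split; first by rewrite /c !starM starX starX' p_star mulrA.
  by rewrite /c !mulrA -(mulrA _ ((t^†) ^+ j)) tX mulr1 -(mulrA _ p p) pp.
have c_orth j k : (j < k)%N -> c j * c k = 0.
  move=> jk; rewrite /c -{1}(subnK jk) addnC addSnnS exprD exprS.
  by rewrite !mulrA -(mulrA (t ^+ j * p)) tX mulr1 -(mulrA (t ^+ j)) pt mulr0 !mul0r.
have [P cP [P_star PP]] := orthogonal_projections cp c_orth.
have AX x n : A x -> A (x ^+ n).
  by move=> Ax; elim: n => [|n ih]; rewrite ?expr0 ?exprS; [exact: vN1|exact: vNM].
have AP : A P.
  apply: vNlim (cP) => // n; apply: vN_sum => // j; rewrite /c.
  by apply: vNM => //; [apply: vNM => //|]; apply: AX => //; exact: vNstar.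
(* Conjugation by [t] moves each copy of [p] to the next one, so it turns the series into the series
   without its first term. *)
have Pp : P = p + t * P * t^†.
  apply: sotcvg_uniq (sotcvg_shift cP) _.
  have := sotcvgD (sotcvg_cst p) (sotcvgMr t^† (sotcvgMl t cP)).
  move=> h u; apply: eq_scvg (h u) => n; congr (bfun _ u).
  rewrite big_ord_recl /c /= !expr0 mul1r mulr1; congr (_ + _).
  rewrite mulr_sumr mulr_suml; apply: eq_bigr => j _.
  by rewrite /bump /= add1n exprS exprSr !mulrA.
have tP : t * P = P * t.
  by rewrite [in RHS]Pp mulrDl pt add0r -!mulrA tt mulr1.
have tP' : P * t^† = t^† * P.
  by have := congr1 (@star R K) tP; rewrite !starM P_star.
have PC : P * (1 - P) = 0 by rewrite mulrBr mulr1 PP subrr.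
have CP : (1 - P) * P = 0 by rewrite mulrBl mul1r PP subrr.
have CC : (1 - P) * (1 - P) = 1 - P by rewrite mulrBr mulr1 CP subr0.
have s_star : (t * P + (1 - P))^† = P * t^† + (1 - P).
  by rewrite starD starM starB star1 P_star.
have AQ : A (1 - P) by apply: vNB => //; exact: vN1.
have QE : 1 - P = 1 - p - t * P * t^† by rewrite [in LHS]Pp opprD addrA.
have PQ : P + (1 - P) = 1 by rewrite addrC subrK.
move: (1 - P) => Q in PC CP CC s_star AQ QE PQ *.
(* Shift by [t] inside [P], identity on the complement [Q]. Only the first room is vacated: the
   range projection [t * P * t^† + Q] is [1 - p]. *)
exists (t * P + Q); rewrite s_star; split.
- by apply: vND => //; exact: vNM.
- have e1 : P * t^† * Q = 0 by rewrite tP' -mulrA PC mulr0.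
  have e2 : Q * (t * P) = 0 by rewrite tP mulrA CP mul0r.
  have e3 : P * t^† * (t * P) = P by rewrite -mulrA (mulrA t^†) tt mul1r PP.
  by rewrite mulrDl !mulrDr CC e1 e2 e3 addr0 add0r.
- have e1 : t * P * Q = 0 by rewrite -mulrA PC mulr0.
  have e2 : Q * (P * t^†) = 0 by rewrite mulrA CP mul0r.
  have e3 : t * P * (P * t^†) = t * P * t^† by rewrite mulrA -(mulrA t) PP.
  by rewrite mulrDl !mulrDr CC e1 e2 e3 addr0 add0r QE addrC subrK.
Qed.

End HilbertHotel.

(** * An isometry with range orthogonal to a Hilbert-Schmidt projection *)

Section AvoidingIsometry.
Variables (R : realType) (K : hilbertType R) (A HS : set (bop K)).
Variables (E : nat -> nat -> bop K) (theta : bop K -> nat -> R).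
Hypothesis vA : vN_set A.
Hypothesis HS_A : HS `<=` A.
Hypothesis HSD : forall S T, HS S -> HS T -> HS (S + T).
Hypothesis HSMl : forall S T, A S -> HS T -> HS (S * T).
Hypothesis HSMr : forall S T, HS S -> A T -> HS (S * T).
Hypothesis E_A : forall i j, A (E i j).
Hypothesis E_star : forall i j, (E i j)^† = E j i.
Hypothesis EM : forall i j k, E i j * E j k = E i k.
Hypothesis E_HS : forall i, HS (E i i).
Hypothesis E_total : forall T, (forall i, E i i * T = 0) -> T = 0.
Hypothesis theta_small : forall q (e : R), HS q -> is_proj q -> 0 < e ->
  exists n, theta q n < e.
(* [theta q n] bounds the size of the part of [E i i] that [E n i] sends into
   the range of [q]. *)
Hypothesis theta_faithful : forall k i, A k -> is_proj k -> E i i * k <> 0 ->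
  exists2 e : R, 0 < e &
    forall q n, A q -> is_proj q -> q * (E n i * k) = E n i * k -> e <= theta q n.

Let E_contractive i j : contractive (E i j).
Proof.
have pE : is_proj (E j j) by split; [exact: E_star|exact: EM].
move=> u; rewrite nsq_star E_star EM -proj_nsq//.
exact: proj_contractive.
Qed.

Let small_proj (q : bop K) := HS q /\ is_proj q.

(** The range projection of [x = (1 - q) * E n i] is [w * w^†] for the polar part [w]. It is
    orthogonal to [q] because [q * x = 0], and it stays in [HS] because [w = w * E i i]. *)
Let step q i (e : R) : small_proj q -> 0 < e -> exists n q',
  [/\ small_proj q', q' * q = q, q' * ((1 - q) * E n i) = (1 - q) * E n i
    & theta q n < e].
Proof.
move=> [Hq [q_star qq]] e0; have Aq := HS_A Hq.
have [n qn] := theta_small Hq (conj q_star qq) e0.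
exists n; set x := (1 - q) * E n i.
have Ax : A x by apply: vNM => //; apply: vNB => //; exact: vN1.
have qx : q * x = 0 by rewrite /x mulrA mulrBr mulr1 qq subrr mul0r.
have [|w [Aw www xw xw']] := polar vA Ax.
  by apply: contractiveM => //; apply/proj_contractive/is_projC.
have kerw T : w^† * T = 0 <-> x^† * T = 0.
  by split=> h; apply: bop_ext => u; apply/xw'; rewrite -bopME h.
have qw : q * w = 0.
  by apply/star_mulr_eq0/kerw/star_mulr_eq0; rewrite !starK.
have wE : w = w * E i i.
  apply/eqP; rewrite -subr_eq0 -[X in X - _]mulr1 -mulrBr; apply/eqP/bop_ext => u.
  apply/xw; rewrite -[RHS](bop0E u) -bopME; congr (bfun _ u).
  by rewrite mulrBr mulr1 /x -mulrA EM subrr.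
have pw : is_proj (w * w^†).
  by split; [rewrite starM starK|rewrite !mulrA www].
have xx : w * w^† * x = x.
  apply/eqP; rewrite eq_sym -subr_eq0 -[X in X - _]mul1r -mulrBl; apply/eqP.
  apply/star_mulr_eq0; rewrite (is_projC pw).1; apply/kerw.
  have www' : w^† * (w * w^†) = w^† by rewrite -[in RHS]www !starM starK.
  by rewrite mulrBr mulr1 www' subrr.
exists (q + w * w^†); split => //.
- split; last by apply: is_projD => //; rewrite mulrA qw mul0r.
  apply: HSD => //; apply: HSMr; last exact: vNstar.
  by rewrite wE; exact: HSMl.
- rewrite mulrDl qq -mulrA -{2}q_star -starM qw star0 mulr0 addr0 //.
- by rewrite mulrDl qx add0r xx.
Qed.

Lemma avoiding_isometry p : HS p -> is_proj p ->
  exists t, [/\ A t, t^† * t = 1 & p * t = 0].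
Proof.
move=> Hp pp.
(* The 2-adic valuation takes every value infinitely often. *)
pose idx j := logn 2 j.+1.
have /choice[F FP] (a : nat * {q | small_proj q}) : exists b : nat * {q | small_proj q},
    let: (j, q) := a in let: (n, q') := b in
    [/\ sval q' * sval q = sval q,
      sval q' * ((1 - sval q) * E n (idx j)) = (1 - sval q) * E n (idx j)
      & theta (sval q) n < j.+1%:R^-1].
  case: a => j [q fq].
  have [|n [q' [fq' h1 h2 h3]]] := @step q (idx j) j.+1%:R^-1 fq.
    by rewrite invr_gt0.
  by exists (n, exist _ q' fq').
pose sq := fix sq j : {q | small_proj q} :=
  if j is j'.+1 then (F (j', sq j')).2 else exist _ p (conj Hp pp).
pose q j := sval (sq j); pose n j := (F (j, sq j)).1.
have qP j : [/\ q j.+1 * q j = q j,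
    q j.+1 * ((1 - q j) * E (n j) (idx j)) = (1 - q j) * E (n j) (idx j)
    & theta (q j) (n j) < j.+1%:R^-1].
  by have := FP (j, sq j); rewrite /q /n /=; case: (F _).
have q_small j : small_proj (q j) by exact: svalP (sq j).
have q_star j : (q j)^† = q j by have [_ []] := q_small j.
have qA j : A (q j) by apply: HS_A; have [] := q_small j.
pose x j := (1 - q j) * E (n j) (idx j).
have q_mono j k : (j <= k)%N -> q k * q j = q j.
  elim: k => [|k ih]; first by rewrite leqn0 => /eqP->; have [_ []] := q_small 0%N.
  rewrite leq_eqVlt => /predU1P[->|/ih e]; first by have [_ []] := q_small k.+1.
  by rewrite -e mulrA; have [-> _ _] := qP k.
have q_monor j k : (j <= k)%N -> q j * q k = q j.
  by move=> /q_mono/(congr1 (@star R K)); rewrite starM !q_star.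
have qx j k : (j < k)%N -> q k * x j = x j.
  by move=> jk; have [_ h _] := qP j; rewrite /x -h mulrA q_mono.
have x_orth j k : (j < k)%N -> (x j)^† * x k = 0.
  move=> jk; apply/star_mul0; rewrite starM (is_projC (q_small k).2).1.
  by rewrite -mulrA mulrBl mul1r qx// subrr mulr0.
have x_contr j : contractive (x j).
  by apply: contractiveM => //; apply/proj_contractive/is_projC; have [] := q_small j.
have xA j : A (x j).
  by apply: vNM => //; apply: vNB => //; exact: vN1.
(* The first [m] weights sum to [1 - 2^-1 ^+ m], so that [y] becomes a contraction, as [polar]
   demands. *)
pose c j : R := 2^-1 ^+ j.+1; pose z j := (c j)%:C *: x j.
have c_gt0 j : 0 < c j by rewrite exprn_gt0// invr_gt0.
have [y zy yc] : exists2 y, sotcvg (fun n => \sum_(j < n) z j) y &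
    forall u, nsq (y u) <= 1 * nsq u.
  apply: orthogonal_series => // [j k jk|m u].
    by rewrite starZ -bopZMl -bopZMr x_orth// !scaler0.
  rewrite mul1r; apply: (@le_trans _ _ ((1 - 2^-1 ^+ m) * nsq u)); last first.
    by rewrite ler_piMl ?nsq_ge0// gerBl exprn_ge0// invr_ge0.
  elim: m => [|m ih]; first by rewrite big_ord0 expr0 subrr mul0r.
  rewrite big_ord_recr /= nsqZ.
  have cm : c m = 2^-1 ^+ m / 2 by rewrite /c exprSr.
  have c1 : c m ^+ 2 * nsq (x m u) <= c m * nsq u.
    rewrite expr2 -mulrA ler_pM2l//; apply: le_trans (x_contr m u).
    by rewrite ler_piMl ?nsq_ge0// /c exprn_ile1// ?invr_ge0// invf_le1// ler1n.
  rewrite (_ : (1 - 2^-1 ^+ m.+1) * nsq u = (1 - 2^-1 ^+ m) * nsq u + c m * nsq u).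
    exact: lerD.
  by rewrite cm exprSr; lra.
have yA : A y.
  by apply: vNlim (zy) => // m; apply: vN_sum => // j; exact: vNZ.
have [|w [Aw www yw yw']] := polar vA yA; first by move=> u; rewrite -[X in _ <= X]mul1r.
have kp : is_proj (1 - w^† * w).
  apply: is_projC; split; first by rewrite starM starK.
  by rewrite -mulrA (mulrA w) www.
(* This projects onto the common kernel of [w] and [y]; [w] is the isometry sought once [k = 0]. *)
set k := 1 - w^† * w in kp.
have Ak : A k by apply: vNB => //; [exact: vN1|apply: vNM => //; exact: vNstar].
have wk : w * k = 0 by rewrite mulrBr mulr1 mulrA www subrr.
have yk : y * k = 0.
  by apply: bop_ext => u; apply/yw; rewrite -bopME wk.
(* Orthogonality of the ranges isolates one term: [(z j)^† * y = (z j)^† * z j], so [y * k = 0]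
   kills [z j * k]. *)
have xk j : x j * k = 0.
  have z_orth i l : (i < l)%N -> (z i)^† * z l = 0.
    by move=> il; rewrite starZ -bopZMl -bopZMr x_orth// !scaler0.
  have zk : z j * k = 0.
    apply: star_mul_self; rewrite starM -!mulrA (mulrA _ (z j)).
    by rewrite -(orthogonal_series_star z_orth j zy) -!mulrA yk !mulr0.
  move: zk; rewrite /z -bopZMl => /(congr1 (fun T => (c j)^-1%:C *: T)).
  by rewrite scalerA -rmorphM/= mulVf ?gt_eqF// scale1r scaler0.
(* When [idx j = i], [x j * k = 0] says that [q j] fixes [E (n j) i * k]. If [E i i * k] is nonzero,
   [theta (q j) (n j)] then has one lower bound [e] for all these [j], although it is below
   [j.+1%:R^-1]. *)
have k0 : k = 0.
  apply: E_total => i; apply: contrapT => Ek.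
  have [e e0 he] := theta_faithful Ak kp Ek.
  have [m me] : exists m, m.+1%:R^-1 < e.
    have /cvgrPdist_lt/(_ e e0)[m _ /(_ m (leqnn m))] := @cvg_harmonic R.
    by rewrite /= sub0r normrN ger0_norm ?invr_ge0// => me; exists m.
  (* The odd cofactor makes the valuation of [j.+1] exactly [i], and its size gives [m <= j], so
     [j.+1%:R^-1] is at most [e]. *)
  pose j := (2 ^ i * m.*2.+1).-1.
  have jS : j.+1 = (2 ^ i * m.*2.+1)%N by rewrite prednK// muln_gt0 expn_gt0.
  have idxj : idx j = i.
    rewrite /idx jS lognM ?expn_gt0// pfactorK// [X in (_ + X)%N]lognE /=.
    by rewrite dvdn2 /= odd_double addn0.
  have [_ _] := qP j; apply/negP; rewrite -leNgt.
  have : j.+1%:R^-1 <= e.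
    apply: le_trans (ltW me); rewrite lef_pV2 ?posrE ?ltr0n// ler_nat jS.
    have := expn_gt0 2 i; rewrite -addnn; nia.
  move/le_trans; apply; apply: he => //; first exact: (q_small j).2.
  have := xk j; rewrite /x idxj -mulrA mulrBl mul1r => /eqP.
  by rewrite subr_eq0 => /eqP.
exists w; split => //.
  by apply/eqP; rewrite eq_sym -subr_eq0; exact/eqP.
have py : p * y = 0.
  apply: sotcvg_uniq (sotcvgMl p zy) _ => u; apply: eq_scvg (scvg_cst 0) => m.
  rewrite mulr_sumr big1// => j _; rewrite /z -bopZMr /x mulrA mulrBr mulr1.
  by rewrite (q_monor 0%N j)// subrr mul0r scaler0.
apply/star_mulr_eq0; apply: bop_ext => u; apply/yw'.
by rewrite -bopME -starM py star0.
Qed.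

End AvoidingIsometry.

(** * Operators on a tensor product *)

Section Density.
Variables (R : realType) (K : hilbertType R).

Lemma dense_rdot_eq0 (D : set K) u : dense D ->
  (forall v, D v -> rdot u v = 0) -> u = 0.
Proof.
move=> dD uD; apply: nsq_eq0; apply/eqP; rewrite eq_le nsq_ge0 andbT.
apply/ler_addgt0Pl => e e0; rewrite addr0.
have s0 : 0 < (Num.sqrt e)%:C by rewrite ltcR sqrtr_gt0.
have [|v [/interior_subset uv Dv]] := dD (ball u (Num.sqrt e)%:C)^° _ (open_interior _).
  by exists u; apply: nbhsx_ballx.
move: uv; rewrite -ball_normE/= norm_lt_nsq ?sqrtr_gt0// sqr_sqrtr; last exact: ltW.
by rewrite nsqB uD// mulr0 subr0 => /ltW; apply: le_trans; rewrite lerDl nsq_ge0.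
Qed.

Lemma cauchy_schwarz (u v : K) : rdot u v ^+ 2 <= nsq u * nsq v.
Proof.
have [v0|v0] := eqVneq (nsq v) 0.
  by rewrite v0 (nsq_eq0 v0) rdot0r mulr0 expr0n.
have {v0}vp : 0 < nsq v by rewrite lt_neqAle eq_sym v0 nsq_ge0.
rewrite -(ler_pM2l vp) -subr_ge0.
have := nsq_ge0 ((nsq v)%:C *: u - (rdot u v)%:C *: v).
by rewrite nsqB !nsqZ rdotZl rdotZr; lra.
Qed.

Lemma nsqZC (a : R[i]) (u : K) :
  nsq (a *: u) = (complex.Re a ^+ 2 + complex.Im a ^+ 2) * nsq u.
Proof.
rewrite {1}/nsq /rdot hinnerZl hinnerZr hinner_nsq.
by case: a => a b /=; lra.
Qed.

Lemma bounded_rank_one (h h' : K) : bounded_ops (fun g : K => ⟪g, h'⟫ *: h).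
Proof.
have lT : linear (fun g : K => ⟪g, h'⟫ *: h).
  by move=> a x y; rewrite hinnerDl hinnerZl scalerDl scalerA.
split=> //; apply/continuous_nsqP => //.
(* Real and imaginary parts of [⟪g, h'⟫] are bounded separately by Cauchy-Schwarz, hence the 2; the
   [+ 1] makes the constant positive. *)
exists (2 * nsq h' * nsq h + 1) => [|g].
  by rewrite ltr_wpDl// !mulr_ge0// nsq_ge0.
rewrite nsqZC hinner_rdot /= sqrrN.
have := cauchy_schwarz g h'; have := cauchy_schwarz ('i *: g) h'; rewrite nsq_i.
have := nsq_ge0 g; have := nsq_ge0 h; nra.
Qed.

End Density.

Section Commutant.
Variables (R : realType) (K : hilbertType R) (S : set (K -> K)).
Hypothesis S_bounded : S `<=` @bounded_ops R K.
Hypothesis S_star : forall T : bop K, S T -> S (T^†).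

Let Sbop f (Sf : S f) : bop K := Bop (S_bounded Sf).

Let SbopE f (Sf : S f) : S (Sbop Sf). Proof. by []. Qed.

Lemma commutantP (T : bop K) :
  commutant S T <-> forall U : bop K, S U -> T * U = U * T.
Proof.
split=> [[_ TS] U SU|TS].
  by apply: bop_ext => u; have := congr1 (@^~ u) (TS _ SU).
split=> [|f Sf]; first exact: bop_bounded.
by have /(congr1 (@bfun R K)) := TS _ (SbopE Sf).
Qed.

Lemma vN_commutant : vN_set [set T : bop K | commutant S T].
Proof.
split.
- by apply/commutantP => U _; rewrite mul1r mulr1.
- move=> T T' /commutantP TS /commutantP TS'; apply/commutantP => U SU.
  by rewrite mulrDl mulrDr TS// TS'.
- move=> T T' /commutantP TS /commutantP TS'; apply/commutantP => U SU.
  by rewrite -mulrA TS'// mulrA TS// mulrA.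
- move=> a T /commutantP TS; apply/commutantP => U SU.
  by rewrite -bopZMl -bopZMr TS.
- move=> T /commutantP TS; apply/commutantP => U SU.
  by have := TS _ (S_star SU) => /(congr1 (@star R K)); rewrite !starM starK.
- move=> Tn T TS TT; apply/commutantP => U SU.
  apply: sotcvg_uniq (sotcvgMr U TT) _ => u.
  apply: eq_scvg (sotcvgMl U TT u) => n.
  by have /commutantP -> := TS n.
Qed.

End Commutant.

Section BicommutantStar.
Variables (R : realType) (K : hilbertType R) (S : set (K -> K)).
Hypothesis S_bounded : S `<=` @bounded_ops R K.
Hypothesis S_star : forall T : bop K, S T -> S (T^†).

Lemma vN_bicommutant : vN_set [set T : bop K | commutant (commutant S) T].
Proof.
apply: vN_commutant; first by move=> T [].
exact: vNstar (vN_commutant S_bounded S_star).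
Qed.

End BicommutantStar.

(** * Slices, matrix units and matrix entries on the tensor product *)

Section TensorOperators.
Variables (R : realType) (H K : hilbertType R) (L : hilbert_tensor H K).
Local Notation "h ⊗ k" := (ht_tensor L h k) (at level 35).

Lemma tensorDl h h' k : (h + h') ⊗ k = h ⊗ k + h' ⊗ k.
Proof. exact: (linearDl (ht_tensor L)). Qed.
Lemma tensorDr h k k' : h ⊗ (k + k') = h ⊗ k + h ⊗ k'.
Proof. exact: (linearDr (ht_tensor L)). Qed.
Lemma tensorZl a h k : (a *: h) ⊗ k = a *: (h ⊗ k).
Proof. exact: (linearZl_LR (ht_tensor L)). Qed.
Lemma tensorZr a h k : h ⊗ (a *: k) = a *: (h ⊗ k).
Proof. exact: (linearZr_LR (ht_tensor L)). Qed.

Lemma nsq_tensor h k : nsq (h ⊗ k) = nsq h * nsq k.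
Proof.
by rewrite /nsq /rdot ht_inner !hinner_nsq -rmorphM.
Qed.

Lemma tensor_total (u : L) : (forall h k, ⟪u, h ⊗ k⟫ = 0) -> u = 0.
Proof.
move=> u0; apply: (dense_rdot_eq0 (@ht_dense _ _ _ L)) => _ [n [h [k ->]]].
by rewrite rdotC rdot_suml big1// => i _; rewrite rdotC /rdot u0.
Qed.

Lemma hinner_ext (V : hilbertType R) (u v : V) :
  (forall w, ⟪u, w⟫ = ⟪v, w⟫) -> u = v.
Proof. by move=> uv; apply: rdot_ext => w; rewrite /rdot uv. Qed.

Lemma tensor_ext (u v : L) : (forall h k, ⟪u, h ⊗ k⟫ = ⟪v, h ⊗ k⟫) -> u = v.
Proof.
move=> uv; apply/eqP; rewrite -subr_eq0; apply/eqP/tensor_total => h k.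
by rewrite [LHS](linearBl hinner); apply/eqP; rewrite subr_eq0; apply/eqP; exact: uv.
Qed.

Lemma bop_tensor_ext (S T : bop L) : (forall h k, S (h ⊗ k) = T (h ⊗ k)) -> S = T.
Proof.
move=> ST; suff : S^† = T^† by move=> /(congr1 (@star R L)); rewrite !starK.
apply: bop_ext => u; apply: tensor_ext => h k.
by rewrite !(is_adjointC (@star_is_adjoint _ _ _)) ST.
Qed.

Lemma tensor_star (T : bop L) (a : bop H) (x : bop K) :
  (forall h k, T (h ⊗ k) = a h ⊗ x k) ->
  forall h k, T^† (h ⊗ k) = a^† h ⊗ x^† k.
Proof.
move=> Tax h k; apply: tensor_ext => h' k'.
rewrite (is_adjointC (@star_is_adjoint _ _ _)) Tax !ht_inner.
by rewrite !(is_adjointC (@star_is_adjoint _ _ _)).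
Qed.

Definition ket (h : H) (k : K) : L := h ⊗ k.

Lemma ket_linear h : linear (ket h).
Proof. by move=> a x y; rewrite /ket tensorDr tensorZr. Qed.

Lemma ket_continuous h : continuous (ket h).
Proof.
apply/(continuous_nsqP (ket_linear h)); exists (nsq h + 1) => [|k].
  by rewrite ltr_wpDl// nsq_ge0.
by rewrite nsq_tensor ler_wpM2r ?nsq_ge0// lerDl.
Qed.

(** The slice map <h| (x) 1, taken as the adjoint of [ket h]. *)
Definition bra h : L -> K :=
  projT1 (cid (hadjoint_exists (ket_linear h) (@ket_continuous h))).

Lemma bra_linear h : linear (bra h).
Proof. by rewrite /bra; case: cid => ? []. Qed.

Lemma bra_continuous h : continuous (bra h).
Proof. by rewrite /bra; case: cid => ? []. Qed.

Lemma ket_bra h k u : ⟪ket h k, u⟫ = ⟪k, bra h u⟫.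
Proof. by rewrite /bra; case: cid => ? []. Qed.

Lemma bra_ket h u k : ⟪bra h u, k⟫ = ⟪u, ket h k⟫.
Proof. by rewrite hinnerC -ket_bra -hinnerC. Qed.

Lemma rdot_bra h u k : rdot (bra h u) k = rdot u (ket h k).
Proof. by rewrite /rdot bra_ket. Qed.

Lemma bra_tensor h h' k : bra h (h' ⊗ k) = ⟪h', h⟫ *: k.
Proof. by apply: hinner_ext => k'; rewrite bra_ket ht_inner hinnerZl. Qed.

Lemma bounded_ketbra h (x : bop K) h' : bounded_ops (ket h \o x \o bra h').
Proof.
split=> [a u v /=|u]; first by rewrite bra_linear (bop_linear x) ket_linear.
apply: continuous_comp; first exact: bra_continuous.
by apply: continuous_comp; [exact: bop_continuous|exact: ket_continuous].
Qed.

(** The operator |h><h'| (x) x. *)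
Definition ketbra h x h' := Bop (bounded_ketbra h x h').

Lemma ketbra_star h x h' : (ketbra h x h')^† = ketbra h' x^† h.
Proof.
apply: star_uniq => u v.
by rewrite /= rdotC -rdot_bra rdotC starP rdot_bra.
Qed.

Lemma bounded_mc h (T : bop L) h' : bounded_ops (bra h \o T \o ket h').
Proof.
split=> [a u v /=|u]; first by rewrite ket_linear (bop_linear T) bra_linear.
apply: continuous_comp; first exact: ket_continuous.
by apply: continuous_comp; [exact: bop_continuous|exact: bra_continuous].
Qed.

(* (<h| (x) 1) T (|h'> (x) 1) *)
Definition mc T h h' := Bop (bounded_mc h T h').

Lemma mcE T h h' k : mc T h h' k = bra h (T (ket h' k)). Proof. by []. Qed.

Lemma rdot_mc T h h' k k' : rdot (mc T h h' k) k' = rdot (T (ket h' k)) (ket h k').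
Proof. by rewrite mcE rdot_bra. Qed.

Lemma mc_star T h h' : (mc T h h')^† = mc T^† h' h.
Proof. by apply: star_uniq => k k'; rewrite rdot_mc starP rdotC -rdot_mc rdotC. Qed.

Lemma mcD S T h h' : mc (S + T) h h' = mc S h h' + mc T h h'.
Proof. by apply: bop_rdot => u v; rewrite bopDE rdotDl !rdot_mc bopDE rdotDl. Qed.

Lemma mcZ (r : R) T h h' : mc (r%:C *: T) h h' = r%:C *: mc T h h'.
Proof. by apply: bop_rdot => u v; rewrite bopZE rdotZl !rdot_mc bopZE rdotZl. Qed.

Lemma mcN T h h' : mc (- T) h h' = - mc T h h'.
Proof. by apply: bop_rdot => u v; rewrite bopNE rdotNl !rdot_mc bopNE rdotNl. Qed.

Lemma mcB S T h h' : mc (S - T) h h' = mc S h h' - mc T h h'.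
Proof. by rewrite mcD mcN. Qed.

Section OrthonormalBasis.
Variables (e : nat -> H) (onb : orthonormal_basis e).

(** For fixed [k] the map [h ↦ h ⊗ k] is bounded. Its adjoint sends [u] to a vector orthogonal to
    every [e i], hence to 0 by density of their span. *)
Lemma onb_total (u : L) : (forall i, bra (e i) u = 0) -> u = 0.
Proof.
move=> u0; apply: tensor_total => h k.
have lS : linear (fun h => h ⊗ k) by move=> a x y; rewrite tensorDl tensorZl.
have cS : continuous (fun h => h ⊗ k).
  apply/(continuous_nsqP lS); exists (nsq k + 1) => [|h'].
    by rewrite ltr_wpDl// nsq_ge0.
  by rewrite nsq_tensor mulrC ler_wpM2r ?nsq_ge0// lerDl.
have [S [_ _ hS]] := hadjoint_exists lS cS.
suff Su : S u = 0 by rewrite hinnerC hS Su (linear0r hinner) rmorph0.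
apply: (dense_rdot_eq0 onb.2) => _ [n [c ->]].
rewrite rdotC rdot_suml big1// => i _.
by rewrite /rdot hinnerZl -hS hinnerC -bra_ket u0 (linear0l hinner) rmorph0 mulr0.
Qed.

Definition unit_op i j := ketbra (e i) 1 (e j).

Lemma bra_e i j k : bra (e i) (ket (e j) k) = (j == i)%:R *: k.
Proof. by rewrite /ket bra_tensor onb.1. Qed.

Lemma bra_ketbra i k x j u :
  bra (e i) (ketbra (e k) x (e j) u) = (k == i)%:R *: x (bra (e j) u).
Proof. exact: bra_e. Qed.

Lemma unit_op_star i j : (unit_op i j)^† = unit_op j i.
Proof. by rewrite ketbra_star star1. Qed.

Lemma unit_opM i j k l : unit_op i j * unit_op k l = (k == j)%:R *: unit_op i l.
Proof.
apply: bop_ext => u; rewrite -[LHS]/(ket (e i) (bra (e j) (unit_op k l u))).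
by rewrite bra_ketbra (linfunZ (@ket_linear _)).
Qed.

Lemma unit_op_proj i : is_proj (unit_op i i).
Proof. by split; [exact: unit_op_star|rewrite unit_opM eqxx scale1r]. Qed.

Lemma unit_op_orth i j : (i < j)%N -> unit_op i i * unit_op j j = 0.
Proof. by move=> ij; rewrite unit_opM gtn_eqF// scale0r. Qed.

Lemma nsq_unit_op i u : nsq (unit_op i i u) = nsq (bra (e i) u).
Proof.
by rewrite (proj_nsq _ (unit_op_proj i)) /= rdotC -rdot_bra.
Qed.

Lemma bra_bessel n u : \sum_(i < n) nsq (bra (e i) u) <= nsq u.
Proof.
apply: le_trans (bessel (fun i => unit_op_proj i) unit_op_orth n u).
by apply: ler_sum => i _; rewrite nsq_unit_op.
Qed.

Lemma unit_op_total (T : bop L) : (forall i, unit_op i i * T = 0) -> T = 0.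
Proof.
move=> UT; apply: bop_ext => u; apply: onb_total => i.
by apply: nsq_eq0; rewrite -nsq_unit_op -bopME UT nsq0.
Qed.

Lemma parseval : sotcvg (fun n => \sum_(i < n) unit_op i i) 1.
Proof.
have [Q UQ _] := orthogonal_projections unit_op_proj unit_op_orth.
suff -> : 1 = Q by [].
apply/eqP; rewrite -subr_eq0; apply/eqP/unit_op_total => i.
have UQi : unit_op i i * Q = unit_op i i * unit_op i i.
  apply: (sotcvg_series_single (z := fun j => unit_op j j)) UQ => j /negPf ji.
  by rewrite unit_opM ji scale0r.
by rewrite mulrBr mulr1 UQi unit_opM eqxx scale1r subrr.
Qed.

(** This is 1 (x) b, summed from its orthogonal diagonal blocks. It brings operators of the
    commutant of [M] to the tensor product. *)
Lemma amplified (b : bop K) : exists B : bop L, forall h k, B (h ⊗ k) = h ⊗ b k.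
Proof.
pose z j := ketbra (e j) b (e j).
have [C C0 bC] := bop_boundP b.
have [B zB _] : exists2 B, sotcvg (fun n => \sum_(j < n) z j) B &
    forall u, nsq (B u) <= C * nsq u.
  apply: orthogonal_series => // [j k jk|n u].
    apply: bop_ext => u; rewrite ketbra_star /= bra_e gtn_eqF// scale0r.
    by rewrite bop_lin0 (linfun0 (@ket_linear _)).
  apply: (@le_trans _ _ (C * \sum_(j < n) nsq (bra (e j) u))).
    rewrite mulr_sumr; apply: ler_sum => j _; rewrite nsq_tensor.
    by rewrite [nsq (e j)](_ : _ = 1) ?mul1r ?bC// /nsq /rdot onb.1 eqxx.
  by rewrite ler_pM2l// bra_bessel.
exists B => h k; apply/eqP; rewrite -subr_eq0; apply/eqP/onb_total => i.
rewrite (linfunB (@bra_linear _)) bra_tensor.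
have BE : unit_op i i * B = unit_op i i * z i.
  apply: (sotcvg_series_single _ zB) => j /negPf ji; apply: bop_ext => u.
  by rewrite /= bra_e ji scale0r (linfun0 (@ket_linear _)).
have := congr1 (fun T : bop L => bra (e i) (T (h ⊗ k))) BE.
rewrite /unit_op !bopME !bra_ketbra eqxx !scale1r /= => ->.
by rewrite bra_tensor bop_linZ subrr.
Qed.

End OrthonormalBasis.

Variable M : II1_factor K.

Lemma II1_bounded : II1_ops M `<=` @bounded_ops R K.
Proof. by have [[]] := II1_factorP M. Qed.

Lemma II1_star (x : bop K) : II1_ops M x -> II1_ops M (x^†).
Proof.
have [[_ Mstar _] _] := II1_factorP M.
by move=> Mx; apply: Mstar Mx _ _; [exact: bop_bounded|exact: star_is_adjoint].
Qed.

Lemma II1_vN : vN_set [set x : bop K | II1_ops M x].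
Proof.
have := vN_bicommutant II1_bounded II1_star.
by have [[_ _ ->] _] := II1_factorP M.
Qed.

Lemma elementary_star (T : bop L) :
  elementary_tensor_op M T -> elementary_tensor_op M (T^†).
Proof.
move=> [_ [a [x [ba Mx Tax]]]]; split; first exact: bop_bounded.
exists (Bop ba)^†, (Bop (II1_bounded Mx))^†; split; first exact: bop_bounded.
  exact: II1_star.
exact: tensor_star.
Qed.

Definition amp : set (bop L) := [set T : bop L | amplification L M T].

Lemma amp_vN : vN_set amp.
Proof. by apply: vN_bicommutant; [move=> T []|exact: elementary_star]. Qed.

Lemma elementary_amp (T : bop L) : elementary_tensor_op M T -> amp T.
Proof.
move=> ET; split; first exact: bop_bounded.
by move=> S [_ SE]; rewrite SE.
Qed.

Lemma unit_op_amp (e : nat -> H) i j : amp (unit_op e i j).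
Proof.
apply: elementary_amp; split; first exact: bop_bounded.
exists (fun g : H => ⟪g, e j⟫ *: e i), idfun; split; first exact: bounded_rank_one.
  exact: (vN1 II1_vN).
by move=> h k; rewrite /= bra_tensor /ket tensorZl tensorZr.
Qed.

(** Membership goes through M'' = M. For [b] in the commutant, 1 (x) b commutes with all elementary
    tensor operators, hence with [T]; slicing turns this into commutation of the entry with [b]. *)
Lemma mc_II1 (e : nat -> H) T h h' : orthonormal_basis e -> amp T ->
  II1_ops M (mc T h h').
Proof.
move=> onb [_ TE]; have [[_ _ <-] _] := II1_factorP M.
split=> [|b [bb bM]]; first exact: bop_bounded.
have [B hB] := amplified onb (Bop bb).
have TB : T * B = B * T.
  apply: bop_ext => u; suff /TE/(congr1 (@^~ u)) : commutant (elementary_tensor_op M) B.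
    by [].
  split=> [|S [bS [a [x [_ Mx Sax]]]]]; first exact: bop_bounded.
  suff : B * Bop bS = Bop bS * B by move=> /(congr1 (@bfun R L)).
  apply: bop_tensor_ext => h0 k0; rewrite !bopME /= Sax !hB Sax /=; congr (_ ⊗ _).
  exact: (congr1 (@^~ k0) (bM _ Mx)).
have hB' := tensor_star (a := 1) hB.
apply/funext => k /=; rewrite -[ket h' (b k)]hB -bopME TB bopME.
apply: hinner_ext => k'; rewrite bra_ket star_is_adjoint.
by rewrite hB' star1 /= -/(ket _ _) -bra_ket -star_is_adjoint.
Qed.

End TensorOperators.

(** * The trace and Hilbert-Schmidt operators *)

Section Trace.
Variables (R : realType) (K : hilbertType R) (M : II1_factor K).
Implicit Types x y : bop K.
Local Notation Mop x := (II1_ops M (bfun x)).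

Definition trM x : R := complex.Re (II1_tr M x).

Lemma II1_sum I (r : seq I) (F : I -> bop K) :
  (forall i, Mop (F i)) -> Mop (\sum_(i <- r) F i).
Proof. exact: (vN_sum (II1_vN M)). Qed.

Lemma II1_mul x y : Mop x -> Mop y -> Mop (x * y).
Proof. exact: (vNM (II1_vN M)). Qed.

Lemma II1_sub x y : Mop x -> Mop y -> Mop (x - y).
Proof. exact: (vNB (II1_vN M)). Qed.

Definition psd x := x^† = x /\ forall u, 0 <= rdot (x u) u.

Lemma psd_positive x : psd x -> positive_op x.
Proof.
move=> [x_star x_pos] u; have := x_pos u.
have e : ⟪u, x u⟫ = ⟪x u, u⟫ by rewrite star_is_adjoint x_star.
have := hinnerC (x u) u; rewrite e /rdot.
case: (⟪x u, u⟫) => a b [{}e]; rewrite lecE /= => ->; rewrite andbT.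
by apply/eqP; lra.
Qed.

Lemma psd_gram x : psd (x^† * x).
Proof.
split=> [|u]; first by rewrite starM starK.
by rewrite -nsq_star nsq_ge0.
Qed.

Lemma psdD x y : psd x -> psd y -> psd (x + y).
Proof.
move=> [x_star x0] [y_star y0]; split=> [|u]; first by rewrite starD x_star y_star.
by rewrite bopDE rdotDl addr_ge0.
Qed.

Lemma psd_sum I (r : seq I) (F : I -> bop K) :
  (forall i, psd (F i)) -> psd (\sum_(i <- r) F i).
Proof.
move=> pF; elim/big_ind: _ => //; last exact: psdD.
by split=> [|u]; rewrite ?star0// rdot0l.
Qed.

Lemma trMD x y : Mop x -> Mop y -> trM (x + y) = trM x + trM y.
Proof.
move=> Mx My; have [tl _ _ _ _] := II1_trP M.
have := tl 1 x y Mx My; rewrite scale1r mul1r => h.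
by rewrite /trM -raddfD -h.
Qed.

Lemma trM0 : trM 0 = 0.
Proof.
have M0 := vN0 (II1_vN M).
by apply: (addrI (trM 0)); rewrite -trMD// !addr0.
Qed.

Lemma trMN x : Mop x -> trM (- x) = - trM x.
Proof.
move=> Mx; apply: (addIr (trM x)); rewrite addNr -trMD ?addNr ?trM0//.
exact: (vNN (II1_vN M)).
Qed.

Lemma trMB x y : Mop x -> Mop y -> trM (x - y) = trM x - trM y.
Proof. by move=> Mx My; rewrite trMD ?trMN//; exact: (vNN (II1_vN M)). Qed.

Lemma trMZ (r : R) x : Mop x -> trM (r%:C *: x) = r * trM x.
Proof.
move=> Mx; have [tl _ _ _ _] := II1_trP M.
have M0 : Mop 0 := vN0 (II1_vN M).
have tau0 : II1_tr M (0 : bop K) = 0.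
  have := tl 1 (0 : bop K) (0 : bop K) M0 M0.
  rewrite scale1r mul1r [X in II1_tr M X](_ : _ = bfun (0 : bop K))//; last first.
    by apply/funext => u; exact: addr0.
  by move=> /eqP; rewrite -subr_eq0 opprD addrA subrr add0r oppr_eq0 => /eqP.
have := tl r%:C x (0 : bop K) Mx M0.
have -> : r%:C *: (x : K -> K) + (0 : bop K) = bfun (r%:C *: x).
  by apply/funext => u; exact: addr0.
rewrite tau0 addr0 /trM => ->; case: (II1_tr M x) => a b /=.
by rewrite mul0r subr0.
Qed.

Lemma trM_sum I (r : seq I) (F : I -> bop K) : (forall i, Mop (F i)) ->
  trM (\sum_(i <- r) F i) = \sum_(i <- r) trM (F i).
Proof.
move=> MF; elim: r => [|i r ih]; first by rewrite !big_nil trM0.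
rewrite !big_cons trMD ?ih//; exact: II1_sum.
Qed.

Lemma trMC x y : Mop x -> Mop y -> trM (x * y) = trM (y * x).
Proof. by move=> Mx My; have [_ _ h _ _] := II1_trP M; rewrite /trM h. Qed.

Lemma trM_psd x : Mop x -> psd x -> II1_tr M x = (trM x)%:C /\ 0 <= trM x.
Proof.
move=> Mx /psd_positive px; have [_ _ _ h _] := II1_trP M.
have [] := h x Mx px; rewrite /trM; case: (II1_tr M x) => a b.
by rewrite lecE/= => /andP[/eqP-> a0] _.
Qed.

Lemma trM_ge0 x : Mop x -> psd x -> 0 <= trM x.
Proof. by move=> Mx px; have [] := trM_psd Mx px. Qed.

Lemma trM_le x y : Mop x -> Mop y -> psd (y - x) -> trM x <= trM y.
Proof.
move=> Mx My pxy; rewrite -subr_ge0 -trMB//; apply: trM_ge0 => //.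
exact: II1_sub.
Qed.

Lemma trM_faithful x : Mop x -> trM (x^† * x) = 0 -> x = 0.
Proof.
move=> Mx t0; apply: star_mul_self.
have Mxx : Mop (x^† * x) by apply: II1_mul => //; exact: II1_star.
have [_ _ _ h _] := II1_trP M.
have [_ xx0] := h _ Mxx (psd_positive (psd_gram x)).
have [te _] := trM_psd Mxx (psd_gram x).
apply: bop_ext => u; rewrite -[RHS]/((0 : K -> K) u) -xx0//.
by rewrite te t0.
Qed.

(** The strong limit of an increasing sequence is its least upper bound in [M], since [rdot] passes
    to the limit; so normality of the trace applies to sequences. *)
Lemma trM_normal (Dn : nat -> bop K) x (C : R) :
  (forall n, Mop (Dn n)) -> (forall n, psd (Dn n)) ->
  (forall n m, (n <= m)%N -> psd (Dn m - Dn n)) ->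
  Mop x -> sotcvg Dn x -> (forall n, psd (x - Dn n)) ->
  (forall n, trM (Dn n) <= C) -> trM x <= C.
Proof.
move=> MD pD mD Mx Dx pxD DC; have [_ _ _ _ normal] := II1_trP M.
pose D : set (K -> K) := [set f | exists n, f = bfun (Dn n)].
have [||||_ /(_ C%:C)] := normal D x.
- by move=> _ [n ->]; exact: MD.
- by move=> _ [n ->]; apply: psd_positive.
- split; first by exists (Dn 0%N), 0%N.
  move=> _ _ [n ->] [m ->]; exists (Dn (maxn n m)); split; first by exists (maxn n m).
    by apply: (psd_positive (mD _ _ (leq_maxl n m))).
  by apply: (psd_positive (mD _ _ (leq_maxr n m))).
- split=> //; first by move=> _ [n ->]; apply: (psd_positive (pxD n)).
  move=> T MT TD u.
  have TDn n : 0 <= ⟪T u - Dn n u, u⟫ by apply: TD; exists n.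
  have xDn n : 0 <= ⟪(x - Dn n) u, u⟫ by exact: psd_positive.
  (* Nonnegativity in [R[i]] includes a zero imaginary part, which a difference of two nonnegative
     numbers has. *)
  have splitT n : ⟪T u - x u, u⟫ = ⟪T u - Dn n u, u⟫ - ⟪(x - Dn n) u, u⟫.
    rewrite -[RHS](linearBl hinner) bopDE bopNE; congr (⟪_, _⟫).
    by rewrite opprB addrA subrK.
  rewrite -[(T - x) u]/(T u - x u) lecE; apply/andP; split.
    rewrite (splitT 0%N); move: (TDn 0%N) (xDn 0%N); rewrite !lecE.
    move: (⟪T u - _, u⟫) (⟪_ u, u⟫) => [a b] [c d] /=.
    by move=> /andP[/eqP-> _] /andP[/eqP-> _]; rewrite subrr.
  rewrite -/(rdot _ _) rdotBl subr_ge0.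
  have c := sotcvg_rdot (u := u) (v := u) Dx.
  rewrite -(cvg_lim _ c)//; apply: limr_le; first by apply/cvg_ex; eexists; exact: c.
  near=> n; have := TDn n; rewrite lecE => /andP[_].
  by rewrite -/(rdot _ _) rdotBl subr_ge0.
- have psdx : psd x.
    have -> : x = (x - Dn 0%N) + Dn 0%N by rewrite subrK.
    exact: psdD.
  rewrite (trM_psd Mx psdx).1 lecR; apply => _ [n ->].
  by rewrite (trM_psd (MD n) (pD n)).1 lecR.
Unshelve. all: by end_near. Qed.

Lemma psd_conj x y : is_proj x -> psd (y * x * y^†).
Proof.
move=> [x_star xx]; have -> : y * x * y^† = (x * y^†)^† * (x * y^†).
  by rewrite starM starK x_star mulrA -(mulrA y x x) xx.
exact: psd_gram.
Qed.

Lemma sotcvg_sum I (r : seq I) (F : nat -> I -> bop K) (G : I -> bop K) :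
  (forall i, sotcvg (F^~ i) (G i)) ->
  sotcvg (fun n => \sum_(i <- r) F n i) (\sum_(i <- r) G i).
Proof.
move=> FG; elim: r => [|i r ih] u.
  by rewrite big_nil; apply: eq_scvg (scvg_cst _) => n; rewrite big_nil.
rewrite big_cons; apply: eq_scvg (sotcvgD (FG i) ih u) => n.
by rewrite big_cons.
Qed.

End Trace.

Section HilbertSchmidt.
Variables (R : realType) (H K : hilbertType R) (L : hilbert_tensor H K).
Variable M : II1_factor K.
Local Notation A := (amp (L := L) M).
Local Notation tr := (trM M).
Implicit Types (e f : nat -> H) (S T : bop L).

(** Finiteness of (Tr (x) tau)(T^† T) computed in the basis [e]; as the terms are nonnegative, a
    common bound on the partial sums expresses it. *)
Definition hs e T := A T /\ exists C : R,
  forall n, \sum_(i < n) tr (mc (T^† * T) (e i) (e i)) <= C.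

Let vA : vN_set A. Proof. exact: amp_vN. Qed.

Lemma psd_mc T h : psd T -> psd (mc T h h).
Proof.
move=> [aT pT]; split=> [|u]; first by rewrite mc_star aT.
by rewrite rdot_mc.
Qed.

Lemma mcMl e S T h h' n : mc (S * (\sum_(i < n) unit_op L e i i) * T) h h' =
  \sum_(i < n) mc S h (e i) * mc T (e i) h'.
Proof.
apply: bop_ext => u; rewrite bop_sumE mcE !bopME bop_sumE.
rewrite (linfun_sum (bop_linear S)) (linfun_sum (@bra_linear _ _ _ _ _)).
by apply: eq_bigr.
Qed.

Lemma sotcvg_mc Tn T h h' : sotcvg Tn T ->
  sotcvg (fun n => mc (Tn n) h h') (mc T h h').
Proof.
move=> TT u; apply: scvg_linear (TT _); first exact: bra_linear.
exact: bra_continuous.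
Qed.

Lemma unit_op_block e n m : orthonormal_basis e -> (n <= m)%N ->
  is_proj (\sum_(i < m) unit_op L e i i - \sum_(i < n) unit_op L e i i).
Proof.
move=> onb; elim: m => [|m ih].
  by rewrite leqn0 => /eqP->; rewrite subrr; split; rewrite ?star0 ?mul0r.
rewrite leq_eqVlt => /predU1P[->|nm].
  by rewrite subrr; split; rewrite ?star0 ?mul0r.
rewrite big_ord_recr /= addrAC; apply: is_projD; [exact: ih|exact: unit_op_proj|].
have kill k : (k <= m)%N -> (\sum_(i < k) unit_op L e i i) * unit_op L e m m = 0.
  move=> km; rewrite mulr_suml big1// => i _.
  by apply: unit_op_orth => //; exact: leq_trans (ltn_ord i) km.
by rewrite mulrBl !kill// subrr.
Qed.

Lemma unit_op_coblock e n : orthonormal_basis e ->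
  is_proj (1 - \sum_(i < n) unit_op L e i i).
Proof.
move=> onb; apply: is_projC.
by have := unit_op_block onb (leq0n n); rewrite big_ord0 subr0.
Qed.

Section Basis.
Variables (e : nat -> H) (onb : orthonormal_basis e).

(** For the entries T_ji between the two bases, tau(T_ji T_ji^†) = tau(T_ji^† T_ji). Summed over i
    they give the diagonal of [T * T^†], summed over finitely many j at most that of [T^† * T].
    Adjoint and change of basis are thus handled at once. *)
Lemma hs_swap f T : orthonormal_basis f -> hs e T -> hs f T^†.
Proof.
move=> onf [AT [C TC]]; have AT' : A T^† by exact: vNstar.
split=> //; exists C => m; rewrite starK.
pose P n := \sum_(i < n) unit_op L e i i.
(* [P n] cuts the sum over [e] to finitely many terms so that sums can be exchanged; normality
   recovers the full sum. *)
pose D n := \sum_(j < m) mc (T * P n * T^†) (f j) (f j).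
have AU i j : A (unit_op L e i j) by exact: unit_op_amp.
have AP n : A (P n) by apply: vN_sum.
have MT S h h' : A S -> II1_ops M (mc S h h') by move=> AS; exact: (mc_II1 _ _ onb).
have AT1 n : A (T * P n * T^†) by do 2 (apply: vNM => //).
have AT2 : A (T * T^†) by exact: vNM.
have AT3 : A (T^† * T) by exact: vNM.
rewrite -trM_sum; last by move=> j; exact: MT.
have projP n m' (nm : (n <= m')%N) : is_proj (P m' - P n) by exact: unit_op_block.
have P0 : P 0%N = 0 by rewrite /P big_ord0.
apply: (@trM_normal _ _ _ D).
- by move=> n; apply: II1_sum => j; exact: MT.
- move=> n; rewrite /D; apply: psd_sum => j; apply/psd_mc/psd_conj.
  by rewrite -[P n]subr0 -P0; exact: projP.
- move=> n m' nm; rewrite /D -sumrB.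
  have -> : \sum_(j < m)
      (mc (T * P m' * T^†) (f j) (f j) - mc (T * P n * T^†) (f j) (f j)) =
    \sum_(j < m) mc (T * (P m' - P n) * T^†) (f j) (f j).
    by apply: eq_bigr => j _; rewrite -mcB mulrBr mulrBl.
  by apply: psd_sum => j; apply/psd_mc/psd_conj/projP.
- by apply: II1_sum => j; exact: MT.
- apply: sotcvg_sum => j; apply: sotcvg_mc.
  by have := sotcvgMr T^† (sotcvgMl T (parseval (L := L) onb)); rewrite mulr1.
- move=> n; rewrite -sumrB.
  have -> : \sum_(j < m)
      (mc (T * T^†) (f j) (f j) - mc (T * P n * T^†) (f j) (f j)) =
    \sum_(j < m) mc (T * (1 - P n) * T^†) (f j) (f j).
    by apply: eq_bigr => j _; rewrite -mcB mulrBr mulr1 mulrBl.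
  by apply: psd_sum => j; apply/psd_mc/psd_conj/unit_op_coblock.
- move=> n; apply: le_trans (TC n).
  rewrite /D trM_sum; last by move=> j; exact: MT.
  under eq_bigr => j _.
    rewrite mcMl trM_sum; last by move=> i; apply: II1_mul; exact: MT.
    over.
  rewrite exchange_big /=; apply: ler_sum => i _.
  have -> : \sum_(j < m) tr (mc T (f j) (e i) * mc T^† (e i) (f j)) =
      \sum_(j < m) tr (mc T^† (e i) (f j) * mc T (f j) (e i)).
    by apply: eq_bigr => j _; apply: trMC; exact: MT.
  rewrite -trM_sum; last by move=> j; apply: II1_mul; exact: MT.
  apply: trM_le.
  + by apply: II1_sum => j; apply: II1_mul; exact: MT.
  + exact: MT.
  + rewrite -mcMl -mcB.
    have -> : T^† * T - T^† * (\sum_(j < m) unit_op L f j j) * T =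
        T^† * (1 - \sum_(j < m) unit_op L f j j) * T^†^†.
      by rewrite starK mulrBr mulr1 mulrBl.
    exact/psd_mc/psd_conj/unit_op_coblock.
Qed.

End Basis.
End HilbertSchmidt.

(** * The Hilbert-Schmidt ideal *)

Section HilbertSchmidtIdeal.
Variables (R : realType) (H K : hilbertType R) (L : hilbert_tensor H K).
Variable M : II1_factor K.
Local Notation A := (amp (L := L) M).
Local Notation tr := (trM M).
Local Notation HS := (hs (L := L) M).
Implicit Types (S T : bop L).

Let vA : vN_set A. Proof. exact: amp_vN. Qed.

Section Ideal.
Variables (e : nat -> H) (onb : orthonormal_basis e).

Let MT S h h' : A S -> II1_ops M (mc S h h').
Proof. by move=> AS; exact: (mc_II1 _ _ onb). Qed.

Lemma hs_le (c : R) S T : 0 <= c -> A S -> HS e T ->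
  psd (c%:C *: (T^† * T) - S^† * S) -> HS e S.
Proof.
move=> c0 AS [AT [C TC]] pST; split=> //; exists (c * C) => n.
apply: le_trans (ler_wpM2l c0 (TC n)); rewrite mulr_sumr; apply: ler_sum => i _.
have AT2 : A (T^† * T) by apply: vNM => //; exact: vNstar.
have AS2 : A (S^† * S) by apply: vNM => //; exact: vNstar.
rewrite -trMZ; last exact: MT.
rewrite -mcZ; apply: trM_le; [exact: MT|apply: MT; exact: vNZ|].
by rewrite -mcB; exact: psd_mc.
Qed.

(** By the parallelogram identity, [(S + T)^† * (S + T)] falls short of twice the sum of the two
    Gram operators by [(S - T)^† * (S - T)]. *)
Lemma hsD S T : HS e S -> HS e T -> HS e (S + T).
Proof.
move=> [AS [C SC]] [AT [D TD]]; split; first exact: vND.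
exists (2 * C + 2 * D) => n.
apply: le_trans (lerD (ler_wpM2l (ler0n _ 2) (SC n)) (ler_wpM2l (ler0n _ 2) (TD n))).
rewrite !mulr_sumr -big_split /=; apply: ler_sum => i _.
have gramA U V : A U -> A V -> A (U^† * V).
  by move=> AU AV; apply: vNM => //; exact: vNstar.
have Mg U V : A U -> A V -> II1_ops M (mc (U^† * V) (e i) (e i)).
  by move=> AU AV; apply: MT; exact: gramA.
rewrite -(trMZ 2 (Mg _ _ AS AS)) -(trMZ 2 (Mg _ _ AT AT)) -!mcZ -trMD; last first.
- by apply: MT; apply: vNZ => //; exact: gramA.
- by apply: MT; apply: vNZ => //; exact: gramA.
rewrite -mcD; apply: trM_le.
- by apply/MT/gramA; exact: vND.
- by apply: MT; apply: vND => //; apply: vNZ => //; exact: gramA.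
- rewrite -mcB; apply: psd_mc.
  have -> : 2%:C *: (S^† * S) + 2%:C *: (T^† * T) - (S + T)^† * (S + T) =
      (S - T)^† * (S - T).
    rewrite starD starB !(mulrDl, mulrDr, mulrN, mulNr); apply: bop_rdot => u v.
    by rewrite !(bopDE, bopNE, rdotDl, rdotNl, bopZE, rdotZl); lra.
  exact: psd_gram.
Qed.

Lemma hsMl S T : A S -> HS e T -> HS e (S * T).
Proof.
move=> AS HT; have [C C0 SC] := bop_boundP S.
apply: (hs_le (ltW C0) _ HT); first by apply: vNM => //; have [] := HT.
split=> [|u]; first by rewrite starB starZ !starM !starK.
by rewrite bopDE bopZE bopNE rdotDl rdotNl rdotZl -!nsq_star subr_ge0 SC.
Qed.

(** The direct estimate exists only for left multiplication; adjoints carry it over. *)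
Lemma hsMr S T : HS e S -> A T -> HS e (S * T).
Proof.
move=> HSS AT; rewrite -[S * T]starK starM; apply: (hs_swap onb) => //.
by apply: hsMl; [exact: vNstar|exact: (hs_swap onb)].
Qed.

Lemma hs0 : HS e 0.
Proof.
split; first exact: vN0.
by exists 0 => n; rewrite big1// => i _; rewrite mulr0 -(subrr 0) mcB subrr trM0.
Qed.

Lemma mc_unit_op i l : mc (unit_op L e i i) (e l) (e l) = (if l == i then 1 else 0).
Proof.
apply: bop_ext => k; rewrite mcE bra_ketbra// bra_e// [i == l]eq_sym.
by case: (l == i); rewrite ?scale1r ?scale0r.
Qed.

Lemma hs_unit_op i : HS e (unit_op L e i i).
Proof.
split; first exact: unit_op_amp.
have [_ tau1 _ _ _] := II1_trP M.
have tr1 : tr 1 = 1 by rewrite /trM tau1.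
exists 1 => n; have [u1 u2] := unit_op_proj L onb i.
rewrite u1 u2; under eq_bigr do rewrite mc_unit_op.
have [ni|ni] := leqP n i.
  rewrite big1// => l _; rewrite ifN ?trM0//.
  by rewrite ltn_eqF// (leq_trans (ltn_ord l)).
rewrite (bigD1 (Ordinal ni))//= eqxx tr1 big1 ?addr0// => l li.
by rewrite ifN ?trM0.
Qed.

Lemma hs_small T (r : R) : HS e T -> 0 < r ->
  exists n, tr (mc (T^† * T) (e n) (e n)) < r.
Proof.
move=> [AT [C TC]] r0; apply: contrapT => /forallNP h.
have lb n : n%:R * r <= C.
  apply: le_trans (TC n); rewrite mulr_natl -[n in _ *+ n]card_ord -sumr_const.
  by apply: ler_sum => i _; rewrite leNgt; exact/negP.
have C0 : 0 <= C by have := lb 0%N; rewrite mul0r.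
have := lb (Num.truncn (C / r)).+1; rewrite -ler_pdivlMr// leNgt.
by rewrite truncnS_gt// divr_ge0// ltW.
Qed.

End Ideal.

(** The trace of [T] is finite in some basis [f] of its own. As [T] is its own adjoint, [hs_swap]
    moves it to the given [e]. *)
Lemma finite_projection_hs (e : nat -> H) T : orthonormal_basis e ->
  @finite_projections _ _ _ L M T -> HS e T.
Proof.
move=> onb [AT [TT T_star] [f [d [onf dT finT]]]].
have {}TT : T * T = T by apply: bop_ext => u; have := congr1 (@^~ u) TT.
have {}T_star : T^† = T by exact: is_adjoint_star.
suff HT : HS f T by rewrite -T_star; exact: (hs_swap onf).
split=> //; rewrite T_star TT.
have dE i : d i = mc T (f i) (f i) :> (K -> K).
  apply/funext => k; have [_ h] := dT i; apply: hinner_ext => k'.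
  by rewrite h mcE bra_ket.
have trd i : complex.Re (II1_tr M (d i)) = tr (mc T (f i) (f i)) by rewrite dE.
have tr0 i : 0 <= tr (mc T (f i) (f i)).
  apply: trM_ge0; first exact: (mc_II1 _ _ onf).
  by apply: psd_mc; rewrite -TT -{1}T_star; exact: psd_gram.
move: finT; under eq_eseriesr do rewrite trd; move=> finT.
set s := (\sum_(0 <= i <oo) _)%E in finT.
have s_fin : s \is a fin_num.
  by rewrite ge0_fin_numE//; apply: nneseries_ge0 => i _ _; rewrite lee_fin.
exists (fine s) => n; rewrite -lee_fin fineK// -sumEFin.
rewrite -(big_mkord xpredT (fun i => (tr (mc T (f i) (f i)))%:E)).
by apply: nneseries_lim_ge => i _ _; rewrite lee_fin.
Qed.

Lemma finite_ideal_hs (e : nat -> H) T : orthonormal_basis e ->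
  finite_ideal L M T -> HS e T.
Proof.
move=> onb IT; pose I : set (L -> L) := [set f | exists2 S : bop L, f = bfun S & HS e S].
suff [S TS] : I T by rewrite (bop_ext (fun u => congr1 (@^~ u) TS)).
apply: IT; split; last first.
  move=> f Ff; have bf := commutant_ops (let: And3 h _ _ := Ff in h).
  by exists (Bop bf) => //; exact: finite_projection_hs.
split.
- by move=> _ [S -> [AS _]].
- by exists 0 => //; exact: hs0.
- by move=> _ _ [S -> HS_] [S' -> HS']; exists (S + S') => //; exact: hsD.
- move=> f _ Af [S -> HS_]; have bf := commutant_ops Af.
  split; [exists (Bop bf * S) => //|exists (S * Bop bf) => //].
    exact: hsMl.
  exact: hsMr.
Qed.

Let theta (e : nat -> H) (q : bop L) n : R := tr (mc q (e n) (e n)).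

Lemma complement_isometry (p : bop L) : finite_ideal L M p -> is_proj p ->
  exists s, [/\ A s, s^† * s = 1 & s * s^† = 1 - p].
Proof.
move=> Ip pp; have [[e onb]|noB] := pselect (exists e : nat -> H, orthonormal_basis e);
    last first.
  (* A finite trace presupposes a basis. Without one there are no finite projections, the ideal is
     zero, and [s = 1] serves. *)
  exists 1; suff -> : p = 0 by rewrite star1 mulr1 subr0; split=> //; exact: vN1.
  pose I : set (L -> L) := [set f | f = bfun (0 : bop L)].
  suff p0 : I p by apply: bop_ext => u; exact: (congr1 (@^~ u) p0).
  apply: Ip; split; last by move=> f [_ _ [e [d [onb _ _]]]]; case: noB; exists e.
  split.
  - by move=> _ ->; exact: (vN0 vA).
  - by [].
  - by move=> _ _ -> ->; apply/funext => u; exact: addr0.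
  - move=> f _ Af ->; have [lf _] := commutant_ops Af.
    by split; apply/funext => u //=; exact: linfun0.
have MT S h h' : A S -> II1_ops M (mc S h h').
  by move=> AS; exact: (mc_II1 _ _ onb).
have Hp : HS e p by exact: finite_ideal_hs.
have [t [At tt pt]] : exists t, [/\ A t, t^† * t = 1 & p * t = 0].
  apply: (@avoiding_isometry _ _ A (HS e) (unit_op L e) (theta e)) => //.
  - by move=> T [].
  - exact: hsD.
  - exact: hsMl.
  - exact: hsMr.
  - exact: unit_op_amp.
  - exact: unit_op_star.
  - by move=> i j k; rewrite unit_opM// eqxx scale1r.
  - exact: hs_unit_op.
  - exact: unit_op_total.
  - move=> q r Hq [q_star qq] r0; have [n] := hs_small Hq r0.
    by rewrite q_star qq; exists n.
  - move=> k i Ak [k_star kk] Ek.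
    have [j mj] : exists j, mc k (e i) (e j) <> 0.
      apply: contrapT => /forallNP m0; apply: Ek.
      have m0' j : mc k (e i) (e j) = 0 by apply: contrapT; exact: m0.
      apply: bop_ext => u; rewrite bopME /unit_op.
      rewrite -[LHS]/(ket L (e i) (bra (e i) (k u))).
      suff -> : bra (e i) (k u) = 0 by rewrite (linfun0 (@ket_linear _ _ _ _ _)).
      apply: rdot_eq0 => v; rewrite rdot_bra starP k_star.
      suff -> : k (ket L (e i) v) = 0 by rewrite rdot0r.
      apply: (onb_total onb) => j; apply: rdot_eq0 => w.
      have := congr1 (@star R K) (m0' j); rewrite mc_star k_star star0 => mj0.
      by rewrite -mcE mj0 rdot0l.
    set m := mc k (e i) (e j) in mj.
    have Mm : II1_ops M m by exact: MT.
    have Mm' : II1_ops M m^† by exact: II1_star.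
    (* The bound is tau(m m^†) for a nonzero entry [m] of [k] in row [i]: positive by faithfulness,
       and independent of [q] and [n]. *)
    exists (tr (m^†^† * m^†)).
      have t0 : 0 <= tr (m^†^† * m^†).
        by apply: trM_ge0 (psd_gram _); apply: II1_mul => //; exact: II1_star.
      rewrite lt_neqAle t0 andbT eq_sym; apply/eqP => /(trM_faithful Mm') m0.
      by apply: mj; rewrite -[m]starK m0 star0.
    move=> q n Aq [q_star qq] qE; rewrite starK.
    set d := mc q (e n) (e n).
    (* The (n, j) entry of [qE]. It gives [m^† = m^† * d], and since [m^†] is a contraction and [d]
       compresses the projection [q], [m * m^†] is at most [d]. *)
    have dm : d * m = m.
      apply: bop_ext => u.
      have := congr1 (fun T : bop L => bra (e n) (T (ket L (e j) u))) qE.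
      by rewrite !bopME !bra_ketbra// eqxx scale1r.
    have d_star : d^† = d by rewrite mc_star q_star.
    have md : m^† * d = m^† by rewrite -d_star -starM dm.
    apply: trM_le; [exact: II1_mul|exact: MT|].
    split=> [|u]; first by rewrite starB starM starK d_star.
    rewrite bopDE bopNE rdotDl rdotNl subr_ge0.
    have -> : rdot ((m * m^†) u) u = nsq (m^† u) by rewrite nsq_star starK.
    rewrite -md bopME.
    have nsq_ket l v : nsq (ket L (e l) v) = nsq v.
      by rewrite nsq_tensor [nsq (e l)](_ : _ = 1) ?mul1r// /nsq /rdot onb.1 eqxx.
    have nsq_bra l (v : L) : nsq (bra (e l) v) <= nsq v.
      rewrite -(nsq_unit_op onb); apply: proj_contractive; exact: unit_op_proj.
    have contr_m v : nsq (m^† v) <= nsq v.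
      rewrite mc_star k_star mcE; apply: le_trans (nsq_bra _ _) _.
      by rewrite -(nsq_ket i v); exact: (proj_contractive (conj k_star kk)).
    apply: le_trans (contr_m _) _; rewrite mcE; apply: le_trans (nsq_bra _ _) _.
    by rewrite rdot_mc -(proj_nsq _ (conj q_star qq)).
by apply: (hilbert_hotel vA pp _ At tt pt); have [] := Hp.
Qed.

End HilbertSchmidtIdeal.

(** * Homomorphisms *)

Section Unitaries.
Variables (R : realType) (H K : hilbertType R) (L : hilbert_tensor H K).
Variable M : II1_factor K.
Local Notation A := (amp (L := L) M).
Local Notation Minf := (finite_ideal L M).
Implicit Types (p q u w : bop L).

Let vA : vN_set A. Proof. exact: amp_vN. Qed.

Lemma finite_ideal_amp p : Minf p -> A p.
Proof.
move=> /(_ (amplification L M)); apply; split; first exact: amplification_ideal.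
by move=> f [].
Qed.

Lemma finite_idealM u p : A u -> Minf p -> Minf (u * p) /\ Minf (p * u).
Proof.
move=> Au Ip; split=> I II; have [[_ _ _ IM] _] := II.
  by have [] := IM u p Au (Ip _ II).
by have [] := IM u p Au (Ip _ II).
Qed.

Definition unitary u := u^† * u = 1 /\ u * u^† = 1.

Lemma extend_unitary p q w : Minf p -> is_proj p -> Minf q -> is_proj q ->
  A w -> w^† * w = p -> w * w^† = q -> exists u, [/\ A u, unitary u & u * p = w].
Proof.
move=> Ip pp Iq pq Aw wp wq.
have [s [As ss sp]] := complement_isometry Ip pp.
have [r [Ar rr rq]] := complement_isometry Iq pq.
have sp0 : s^† * p = 0.
  have -> : p = 1 - s * s^† by rewrite sp opprB addrC subrK.
  by rewrite mulrBr mulr1 mulrA ss mul1r subrr.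
have rq0 : r^† * q = 0.
  have -> : q = 1 - r * r^† by rewrite rq opprB addrC subrK.
  by rewrite mulrBr mulr1 mulrA rr mul1r subrr.
(* All four terms of [(w - w * p)^† * (w - w * p)] equal [p] and cancel. *)
have wpw : w * p = w.
  apply/eqP; rewrite eq_sym -subr_eq0; apply/eqP/star_mul_self.
  have e1 : w^† * (w * p) = p by rewrite mulrA wp pp.2.
  have e2 : p * w^† * w = p by rewrite -mulrA wp pp.2.
  have e3 : p * w^† * (w * p) = p by rewrite mulrA e2 pp.2.
  by rewrite starB starM pp.1 mulrBl !mulrBr wp e1 e2 e3 !subrr.
have qw : q * w = w by rewrite -wq -mulrA wp.
have rw : r^† * w = 0 by rewrite -qw mulrA rq0 mul0r.
have wr : w^† * r = 0 by apply/star_mul0.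
have ws : w * s = 0.
  by rewrite -wpw -mulrA -pp.1 -[s]starK -starM sp0 star0 mulr0.
have sw : s^† * w^† = 0 by rewrite -starM ws star0.
have u_star : (w + r * s^†)^† = w^† + s * r^† by rewrite starD starM starK.
exists (w + r * s^†); rewrite /unitary u_star; split; first 2 last.
- by rewrite mulrDl wpw -mulrA sp0 mulr0 addr0.
- by apply: vND => //; apply: vNM => //; exact: vNstar.
split; rewrite mulrDl !mulrDr.
- rewrite wp (mulrA w^†) wr mul0r -(mulrA s) rw mulr0 addr0 add0r.
  by rewrite mulrA -(mulrA s) rr mulr1 sp addrC subrK.
- rewrite wq (mulrA w) ws mul0r -(mulrA r) sw mulr0 addr0 add0r.
  by rewrite mulrA -(mulrA r) ss mulr1 rq addrC subrK.
Qed.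

(** The isometry [r] moves [p] below [1 - q] but need not be unitary. Only its restriction [r * p]
    is kept, a partial isometry between projections of the ideal, and that one extends. *)
Lemma orthogonal_conjugate p q : Minf p -> is_proj p -> Minf q -> is_proj q ->
  exists u, [/\ A u, unitary u & u * p * u^† * q = 0].
Proof.
move=> Ip pp Iq pq; have [r [Ar rr rq]] := complement_isometry Iq pq.
have rq0 : r^† * q = 0.
  have -> : q = 1 - r * r^† by rewrite rq opprB addrC subrK.
  by rewrite mulrBr mulr1 mulrA rr mul1r subrr.
have wp : (r * p)^† * (r * p) = p.
  by rewrite starM pp.1 -mulrA (mulrA r^†) rr mul1r pp.2.
have Aw : A (r * p) by apply: vNM => //; exact: finite_ideal_amp.
have [||u [Au uu up]] := extend_unitary Ip pp _ _ Aw wp erefl.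
- apply: (finite_idealM _ _).2; first exact: vNstar.
  exact: (finite_idealM Ar Ip).1.
- split; first by rewrite starM starK.
  by rewrite mulrA -(mulrA (r * p)) wp -(mulrA r p p) pp.2.
exists u; split=> //.
have pu : p * u^† = p * r^†.
  by have := congr1 (@star R L) up; rewrite !starM pp.1.
have -> : u * p * u^† = u * p * (p * u^†) by rewrite mulrA -(mulrA u p p) pp.2.
by rewrite pu -!mulrA rq0 !mulr0.
Qed.

End Unitaries.

(** * Addition of unitary equivalence classes *)

Section HomSemigroup.
Variables (R : realType) (H KN K : hilbertType R) (L : hilbert_tensor H K).
Variables (N : II1_factor KN) (M : II1_factor K).
Local Notation A := (amp (L := L) M).
Local Notation Minf := (finite_ideal L M).
Local Notation hom := (star_hom L N M).
Implicit Types (f g : hom).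

Let vA : vN_set A. Proof. exact: amp_vN. Qed.

(** [star_hom] constrains only values on [N], so boundedness of [f x] depends on the membership
    proof [Nx]. *)
Definition hom_bop f x (Nx : II1_ops N x) : bop L :=
  Bop (finite_ideal_ops (shom_in f Nx)).

Local Notation unit f := (hom_bop f (II1_id N)).

Lemma hom_bop_finite f x (Nx : II1_ops N x) : Minf (hom_bop f Nx).
Proof. exact: shom_in. Qed.

Lemma unit_mull f x (Nx : II1_ops N x) : unit f * hom_bop f Nx = hom_bop f Nx.
Proof.
apply: bop_ext => v.
exact: (esym (congr1 (@^~ v) (shom_mul f (II1_id N) Nx))).
Qed.

Lemma unit_mulr f x (Nx : II1_ops N x) : hom_bop f Nx * unit f = hom_bop f Nx.
Proof.
apply: bop_ext => v.
exact: (esym (congr1 (@^~ v) (shom_mul f Nx (II1_id N)))).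
Qed.

Lemma unit_proj f : is_proj (unit f).
Proof.
split; last exact: unit_mull.
by apply: is_adjoint_star; apply: shom_star => //; exact: II1_id.
Qed.

Lemma orthogonal_homsE f g : orthogonal_homs f g <-> unit f * unit g = 0.
Proof.
split=> [fg|fg]; first by apply: bop_ext => v; exact: (congr1 (@^~ v) fg).
by apply/funext => v; exact: (congr1 (fun T : bop L => T v) fg).
Qed.

Lemma hom_classP f g : hom_class f = hom_class g <-> unitary_conj f g.
Proof.
split=> [/eqmodP/asboolP//|fg].
by apply/eqmodP/asboolP.
Qed.

Lemma hom_class_ext f g : (forall x, II1_ops N x -> f x = g x) ->
  hom_class f = hom_class g.
Proof.
move=> fg; apply/hom_classP; exists idfun, idfun; split=> //.
by split=> //; exact: amplification_id.
Qed.

Lemma unitary_conjP f g : unitary_conj f g <-> exists u : bop L,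
  [/\ A u, unitary u & forall x (Nx : II1_ops N x),
     hom_bop f Nx = u * hom_bop g Nx * u^†].
Proof.
split=> [[u [v [[Au Av uv] uvK vuK fg]]]|[u [Au [uu uu'] fg]]]; last first.
  exists u, u^†; split=> //.
  - by split=> //; [exact: (vNstar vA)|exact: star_is_adjoint].
  - exact: (congr1 (@bfun R L) uu').
  - exact: (congr1 (@bfun R L) uu).
  - by move=> x Nx; exact: (congr1 (@bfun R L) (fg x Nx)).
have bu := commutant_ops Au; have bv := commutant_ops Av.
have uvs : (Bop bu)^† = Bop bv by exact: is_adjoint_star.
exists (Bop bu); rewrite /unitary uvs; split=> //.
  split; apply: bop_ext => w; first exact: (congr1 (@^~ w) vuK).
  exact: (congr1 (@^~ w) uvK).
by move=> x Nx; apply: bop_ext => w; exact: (congr1 (@^~ w) (fg x Nx)).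
Qed.

Section Conjugate.
Variables (f : hom) (u : bop L) (Au : A u) (uu : unitary u).

Let cf x : L -> L := (u : L -> L) \o f x \o (u^† : L -> L).

Let cfE x (Nx : II1_ops N x) : cf x = u * hom_bop f Nx * u^†. Proof. by []. Qed.

Lemma conj_hom_in x : II1_ops N x -> Minf (cf x).
Proof.
move=> Nx; rewrite (cfE Nx); apply: (finite_idealM _ _).2; first exact: vNstar.
by apply: (finite_idealM Au _).1; exact: shom_in.
Qed.

Lemma conj_hom_lin (a : R[i]) x y : II1_ops N x -> II1_ops N y ->
  cf (a *: x + y) = a *: cf x + cf y.
Proof.
by move=> Nx Ny; apply/funext => v; rewrite /cf /= shom_lin// (bop_linear u).
Qed.

Lemma conj_hom_mul x y : II1_ops N x -> II1_ops N y -> cf (x \o y) = cf x \o cf y.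
Proof.
move=> Nx Ny; apply/funext => v; rewrite /cf /= shom_mul//=.
by rewrite -[u^† (u _)]/((u^† * u) _) uu.1.
Qed.

Lemma conj_hom_star x y : II1_ops N x -> II1_ops N y -> is_adjoint x y ->
  is_adjoint (cf x) (cf y).
Proof.
move=> Nx Ny xy; rewrite /cf -compA.
apply: is_adjoint_comp; first exact: star_is_adjoint.
apply: is_adjoint_comp; first exact: shom_star.
exact/is_adjointC/star_is_adjoint.
Qed.

Definition conj_hom : hom :=
  StarHom conj_hom_in conj_hom_lin conj_hom_mul conj_hom_star.

Lemma conj_hom_class : hom_class conj_hom = hom_class f.
Proof.
apply/hom_classP/unitary_conjP; exists u; split=> // x Nx.
exact: bop_ext.
Qed.

End Conjugate.

Lemma orthogonal_representative f g : exists2 f',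
  hom_class f' = hom_class f & orthogonal_homs f' g.
Proof.
have [u [Au uu ufg]] := orthogonal_conjugate (hom_bop_finite f (II1_id N))
  (unit_proj f) (hom_bop_finite g (II1_id N)) (unit_proj g).
exists (conj_hom f Au uu); first exact: conj_hom_class.
by apply/orthogonal_homsE; rewrite -ufg; exact: bop_ext.
Qed.

(** The two summands are conjugated by different unitaries [u] and [v]. Their corners glue to the
    partial isometry [u * p + v * q] from f'(1) + g'(1) to f(1) + g(1); a single unitary extending
    it conjugates both summands. *)
Lemma sum_hom_class f f' g g' (o : orthogonal_homs f g) (o' : orthogonal_homs f' g') :
  hom_class f = hom_class f' -> hom_class g = hom_class g' ->
  hom_class (sum_hom o) = hom_class (sum_hom o').
Proof.
move=> /hom_classP/unitary_conjP[u [Au [uu uu'] fu]].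
move=> /hom_classP/unitary_conjP[v [Av [vv vv'] gv]].
have [p_star pp] := unit_proj f'; have [q_star qq] := unit_proj g'.
set p := unit f' in p_star pp; set q := unit g' in q_star qq.
have pq : p * q = 0 by exact/orthogonal_homsE.
have qp : q * p = 0 by rewrite -p_star -q_star -starM pq star0.
have pq0 : (u * p * u^†) * (v * q * v^†) = 0.
  by rewrite -!fu -!gv; exact/orthogonal_homsE.
(* The ranges of [u * p] and [v * q] are those of f(1) and g(1), hence orthogonal. *)
have cross : p * u^† * (v * q) = 0.
  have -> : p * u^† * (v * q) = u^† * (u * p * u^† * (v * q * v^†)) * v.
    rewrite !mulrA uu mul1r -(mulrA _ v^†) vv mulr1 //.
  by rewrite pq0 mulr0 mul0r.
have cross' : q * v^† * (u * p) = 0.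
  by have := congr1 (@star R L) cross; rewrite !starM !starK p_star q_star star0.
pose w := u * p + v * q.
have w_star : w^† = p * u^† + q * v^† by rewrite starD !starM p_star q_star.
have ww : w^† * w = p + q.
  rewrite w_star mulrDl !mulrDr cross cross' addr0 add0r.
  by rewrite !mulrA -(mulrA p) uu mulr1 pp -(mulrA q) vv mulr1 qq.
have ww' : w * w^† = u * p * u^† + v * q * v^†.
  have e1 : u * p * (p * u^†) = u * p * u^† by rewrite mulrA -(mulrA u p p) pp.
  have e2 : u * p * (q * v^†) = 0 by rewrite mulrA -(mulrA u p q) pq mulr0 mul0r.
  have e3 : v * q * (p * u^†) = 0 by rewrite mulrA -(mulrA v q p) qp mulr0 mul0r.
  have e4 : v * q * (q * v^†) = v * q * v^† by rewrite mulrA -(mulrA v q q) qq.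
  by rewrite w_star mulrDl !mulrDr e1 e2 e3 e4 addr0 add0r.
have Ip : Minf p by exact: hom_bop_finite.
have Iq : Minf q by exact: hom_bop_finite.
have [|||||||U [AU UU Uw]] := @extend_unitary _ _ _ L M (p + q)
    (u * p * u^† + v * q * v^†) w.
- exact: finite_idealD.
- exact: is_projD.
- by rewrite -!fu -!gv; apply: finite_idealD; exact: hom_bop_finite.
- rewrite -!fu -!gv; apply: is_projD; do ?exact: unit_proj.
  exact/orthogonal_homsE.
- by apply: vND => //; apply: vNM => //; exact: finite_ideal_amp.
- exact: ww.
- exact: ww'.
apply/hom_classP/unitary_conjP; exists U; split=> // x Nx.
have -> : hom_bop (sum_hom o') Nx = hom_bop f' Nx + hom_bop g' Nx by exact: bop_ext.
have -> : hom_bop (sum_hom o) Nx = hom_bop f Nx + hom_bop g Nx by exact: bop_ext.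
rewrite fu gv mulrDr mulrDl.
have pX := unit_mull f' Nx; have Xp := unit_mulr f' Nx.
have qY := unit_mull g' Nx; have Yq := unit_mulr g' Nx.
move: (hom_bop f' Nx) (hom_bop g' Nx) pX Xp qY Yq => X Y; rewrite -/p -/q => pX Xp qY Yq.
have Uw' : (p + q) * U^† = w^† by rewrite -Uw starM starD p_star q_star.
have qX : q * X = 0 by rewrite -pX mulrA qp mul0r.
have Xq : X * q = 0 by rewrite -Xp -mulrA pq mulr0.
have pY : p * Y = 0 by rewrite -qY mulrA pq mul0r.
have Yp : Y * p = 0 by rewrite -Yq -mulrA qp mulr0.
(* [X] lives in the corner of [p], where [U] acts as [u]; likewise [Y] and [v] for [q]. *)
have -> : U * X = u * X.
  have -> : U * X = U * ((p + q) * X) by rewrite mulrDl pX qX addr0.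
  by rewrite mulrA Uw mulrDl -!mulrA pX qX mulr0 addr0.
have -> : U * Y = v * Y.
  have -> : U * Y = U * ((p + q) * Y) by rewrite mulrDl pY qY add0r.
  by rewrite mulrA Uw mulrDl -!mulrA pY qY mulr0 add0r.
have XU : X * U^† = X * u^†.
  have -> : X * U^† = X * ((p + q) * U^†) by rewrite mulrA mulrDr Xp Xq addr0.
  by rewrite Uw' w_star mulrDr !mulrA Xp Xq mul0r addr0.
have YU : Y * U^† = Y * v^†.
  have -> : Y * U^† = Y * ((p + q) * U^†) by rewrite mulrA mulrDr Yp Yq add0r.
  by rewrite Uw' w_star mulrDr !mulrA Yp Yq mul0r add0r.
by rewrite -!mulrA XU YU.
Qed.

End HomSemigroup.

Theorem lemma5 (R : realType) (H KN K : hilbertType R)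
    (H_separable : separable H)
    (H_infinite : infinite_dimensional [set: H])
    (L : hilbert_tensor H K) (N : II1_factor KN) (M : II1_factor K) :
  exists plus : HomInf L N M -> HomInf L N M -> HomInf L N M,
    [/\ forall phi psi : star_hom L N M,
          (exists2 phi', hom_class phi' = hom_class phi &
             orthogonal_homs phi' psi) /\
          (forall phi' (o : orthogonal_homs phi' psi),
             hom_class phi' = hom_class phi ->
             plus (hom_class phi) (hom_class psi) = hom_class (sum_hom o)),
        associative plus
      & commutative plus].
Proof.
(* All orthogonal representatives of a pair of classes have the same sum class by [sum_hom_class],
   and such representatives exist; choice selects this common value. *)
have /choice[plus0 plus0P] (ab : HomInf L N M * HomInf L N M) : exists c,
    forall f g (o : orthogonal_homs f g),
      hom_class f = ab.1 -> hom_class g = ab.2 -> c = hom_class (sum_hom o).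
  case: ab => a b; have ra : hom_class (repr a) = a := reprK a.
  have rb : hom_class (repr b) = b := reprK b.
  have [f fa o] := orthogonal_representative (repr a) (repr b).
  exists (hom_class (sum_hom o)) => f' g' o' /= f'a g'b.
  by apply: sum_hom_class; rewrite ?fa ?ra ?rb.
pose plus a b := plus0 (a, b).
have plusE f g (o : orthogonal_homs f g) :
    plus (hom_class f) (hom_class g) = hom_class (sum_hom o).
  exact: plus0P.
have rep (f : star_hom L N M) (b : HomInf L N M) : exists f' g,
    [/\ hom_class f' = hom_class f, hom_class g = b
    & orthogonal_homs f' g].
  have [f' f'f o] := orthogonal_representative f (repr b).
  by exists f', (repr b); split=> //; exact: reprK.
exists plus; split=> [f g|a b c|a b].
- split; first exact: orthogonal_representative.
  by move=> f' o f'f; rewrite -f'f plusE.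
- have [g [h [gb hc gh]]] := rep (repr b) c.
  (* Orthogonality of [f] to the sum splits on multiplying by g(1) and h(1). All three are then
     pairwise orthogonal, and both bracketings are the same pointwise sum. *)
  have [f fa f_gh] := orthogonal_representative (repr a) (sum_hom gh).
  have {}gb : hom_class g = b by rewrite gb; exact: reprK.
  have {}fa : hom_class f = a by rewrite fa; exact: reprK.
  have [fg fh] : orthogonal_homs f g /\ orthogonal_homs f h.
    have /orthogonal_homsE ghE := gh.
    have /orthogonal_homsE hgE := orthogonal_homsC gh.
    have /orthogonal_homsE := f_gh.
    have -> : hom_bop (sum_hom gh) (II1_id N) =
      hom_bop g (II1_id N) + hom_bop h (II1_id N) by exact: bop_ext.
    move=> e; split; apply/orthogonal_homsE.
      have := congr1 (fun T => T * hom_bop g (II1_id N)) e.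
      by rewrite mul0r -mulrA mulrDl hgE addr0 (unit_proj g).2.
    have := congr1 (fun T => T * hom_bop h (II1_id N)) e.
    by rewrite mul0r -mulrA mulrDl ghE add0r (unit_proj h).2.
  have fg_h : orthogonal_homs (sum_hom fg) h.
    apply/orthogonal_homsE.
    have -> : hom_bop (sum_hom fg) (II1_id N) =
      hom_bop f (II1_id N) + hom_bop g (II1_id N) by exact: bop_ext.
    have /orthogonal_homsE e1 := fh; have /orthogonal_homsE e2 := gh.
    by rewrite mulrDl e1 e2 addr0.
  rewrite -fa -gb -hc (plusE _ _ gh) (plusE _ _ fg) (plusE _ _ f_gh) (plusE _ _ fg_h).
  by apply: hom_class_ext => x Nx; exact: addrA.
- have [f [g [fa gb fg]]] := rep (repr a) b.
  have {}fa : hom_class f = a by rewrite fa; exact: reprK.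
  have gf : orthogonal_homs g f by exact: orthogonal_homsC fg.
  rewrite -fa -gb (plusE _ _ fg) (plusE _ _ gf).
  by apply: hom_class_ext => x Nx; exact: addrC.
Qed.
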